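(* Let $\Lambda$ be an Artinian algebra with infinite dominant dimension. Then the following statements are equivalent. (1) $\Lambda$ is self-injective. (2) $\mathrm{fin.dim}\,\Lambda=0$. (3) The right annihilator of any proper left ideal of $\Lambda$ is non-zero. (4) The right annihilator of any maximal left ideal of $\Lambda$ is non-zero. (5) $\mathrm{grade}\,M<\infty$ for any non-zero finitely generated left $\Lambda$-module $M$. (6) $\mathrm{grade}\,S<\infty$ for any simple left $\Lambda$-module $S$.
   Context: ''Artinian algebra'' is meant in the standard sense of Artin algebra (an algebra over a commutative Artinian ring that is finitely generated as a module over it). Let $0\to{}_\Lambda\Lambda\to I'_0\to I'_1\to\cdots$ be a minimal injective resolution of $\Lambda$ as a left module. $\Lambda$ has dominant dimension at least $k$ if $I'_i$ is flat for all $0\le i\le k-1$, and infinite dominant dimension if all $I'_i$, $i\ge0$, are flat. $\mathrm{fin.dim}\,\Lambda$ is the supremum of the projective dimensions of all finitely generated left $\Lambda$-modules of finite projective dimension. For a finitely generated left module $M$, $\mathrm{grade}\,M\ge i$ means $\mathrm{Ext}^j_\Lambda(M,\Lambda)=0$ for all $0\le j<i$; thus $\mathrm{grade}\,M<\infty$ means $\mathrm{Ext}^j_\Lambda(M,\Lambda)\ne0$ for some $j\ge0$. The right annihilator of a left ideal $I$ is $\{x\in\Lambda: Ix=0\}$. *)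

(* Defs.v *)
From HB Require Import structures.
From mathcomp Require Import all_boot all_order all_algebra.
From mathcomp Require Import generic_quotient ring_quotient.
From mathcomp Require Import boolp classical_sets.
From mathcomp Require Import freeg.

Set Implicit Arguments.
Unset Strict Implicit.
Unset Printing Implicit Defensive.

Import GRing.Theory.
Local Open Scope ring_scope.
Local Open Scope classical_set_scope.
Local Open Scope quotient_scope.

(* Left R-modules are lmodType R; right R-modules are lmodType R^c, where R^c
   is the converse ring, so that a.r is (r : R^c) *: a.  The left regular
   module is R^o. *)

Definition submodule (R : nzRingType) (M : lmodType R) (S : set M) : Prop :=
  S 0 /\ forall (r : R) (x y : M), S x -> S y -> S (r *: x + y).

Definition nonzero_module (R : nzRingType) (M : lmodType R) : Prop :=
  exists x : M, x <> 0.

Definition simple_module (R : nzRingType) (M : lmodType R) : Prop :=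
  nonzero_module M /\
  forall S : set M, submodule S -> S = [set 0] \/ S = [set: M].

Definition fin_generated (R : nzRingType) (M : lmodType R) : Prop :=
  exists (n : nat) (e : 'I_n -> M), forall x : M,
    exists c : 'I_n -> R, x = \sum_(i < n) c i *: e i.

Definition left_ideal (R : nzRingType) (I : set R) : Prop :=
  @submodule R R^o I.

Definition proper_left_ideal (R : nzRingType) (I : set R) : Prop :=
  left_ideal I /\ I <> [set: R].

Definition maximal_left_ideal (R : nzRingType) (I : set R) : Prop :=
  proper_left_ideal I /\
  forall J : set R, proper_left_ideal J -> I `<=` J -> J = I.

Definition right_annihilator (R : nzRingType) (I : set R) : set R :=
  [set x | forall y, I y -> y * x = 0].

Definition artinian_comring (k : comNzRingType) : Prop :=
  forall I : nat -> set k,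
    (forall n, left_ideal (I n)) -> (forall n, I n.+1 `<=` I n) ->
    exists N, forall n, (N <= n)%N -> I n = I N.

Definition artin_algebra (k : comNzRingType) (L : algType k) : Prop :=
  artinian_comring k /\ @fin_generated k L.

(* A \otimes_R M is the free abelian group on A * M modulo the subgroup
   tensor_rel generated by the biadditivity and balancing relations. *)
Section Tensor.
Variables (R : nzRingType) (A : lmodType R^c) (M : lmodType R).

Inductive tensor_rel : {freeg (A * M)} -> Prop :=
| tensor_rel0 : tensor_rel 0
| tensor_relB x y : tensor_rel x -> tensor_rel y -> tensor_rel (x - y)
| tensor_relDl (a a' : A) (m : M) :
    tensor_rel (<< (a + a', m) >> - << (a, m) >> - << (a', m) >>)
| tensor_relDr (a : A) (m m' : M) :
    tensor_rel (<< (a, m + m') >> - << (a, m) >> - << (a, m') >>)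
| tensor_relZ (a : A) (r : R) (m : M) :
    tensor_rel (<< ((r : R^c) *: a, m) >> - << (a, r *: m) >>).

Definition tensor_ker : {pred {freeg (A * M)}} := fun x => `[< tensor_rel x >].

Lemma tensor_ker_zmod_closed : zmod_closed tensor_ker.
Proof.
split=> [|x y]; first exact/asboolP/tensor_rel0.
by move=> /asboolP hx /asboolP hy; apply/asboolP/tensor_relB.
Qed.

HB.instance Definition _ :=
  GRing.isZmodClosed.Build {freeg (A * M)} tensor_ker tensor_ker_zmod_closed.

Definition tensor : zmodType := Quotient.quot tensor_ker.

Definition tens (a : A) (m : M) : tensor :=
  \pi_(Quotient.quot tensor_ker) << (a, m) >>.

Definition balanced (Z : zmodType) (b : A -> M -> Z) : Prop :=
  [/\ forall a a' m, b (a + a') m = b a m + b a' m,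
      forall a m m', b a (m + m') = b a m + b a m'
    & forall a (r : R) m, b ((r : R^c) *: a) m = b a (r *: m)].

(* The homomorphism induced by b is only meaningful for balanced b; see
   tensor_liftE and tensor_lift_is_zmod_morphism. *)
Definition tensor_lift (Z : zmodType) (b : A -> M -> Z) (t : tensor) : Z :=
  fglift (fun p : A * M => b p.1 p.2 : zmodule Z)
         (repr (t : Quotient.quot tensor_ker)).

Lemma tens_ind (P : tensor -> Prop) :
  P 0 -> (forall t a m, P t -> P (t + tens a m)) ->
  (forall t a m, P t -> P (t - tens a m)) -> forall t, P t.
Proof.
move=> P0 PD PB; elim/quotW => x; rewrite -(freeg_sumE x).
elim: (dom x) => [|p s IHs]; first by rewrite big_nil raddf0.
rewrite big_cons addrC raddfD /=; set t := \pi _ in IHs *.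
have -> : << coeff p x *g p >> = << p >> *~ coeff p x :> {freeg (A * M)}.
  by rewrite freegU_mulz intz.
case: (coeff p x) => n; rewrite ?NegzE ?mulrNz -pmulrn ?raddfN raddfMn /=;
  case: p => a m; rewrite -/(tens a m).
- elim: n => [|n IHn]; first by rewrite mulr0n addr0.
  by rewrite mulrSr addrA; apply: PD.
- elim: n.+1 => [|n' IHn]; first by rewrite mulr0n subr0.
  by rewrite mulrSr opprD addrA; apply: PB.
Qed.

Lemma tens_balanced : balanced tens.
Proof.
split=> *; apply/eqP; rewrite -subr_eq0 ?opprD ?addrA /tens -?raddfB /=;
  apply/eqP; rewrite -[RHS](raddf0 (\pi_(Quotient.quot tensor_ker)));
  apply/eqmodP; rewrite /= /Quotient.equiv subr0; apply/asboolP.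
- exact: tensor_relDl.
- exact: tensor_relDr.
- exact: tensor_relZ.
Qed.

Section Lift.
Variables (Z : zmodType) (b : A -> M -> Z).
Hypothesis bal : balanced b.

Lemma tensor_lift_pi (x : {freeg (A * M)}) :
  tensor_lift b (\pi_(Quotient.quot tensor_ker) x) =
  fglift (fun p : A * M => b p.1 p.2 : zmodule Z) x.
Proof.
rewrite /tensor_lift; set F := fglift _.
have FB : zmod_morphism F by exact: lift_is_additive.
pose FA := GRing.isZmodMorphism.Build _ _ F FB.
pose Fa : {additive {freeg (A * M)} -> zmodule Z} := HB.pack F FA.
have F1 a m : F << (a, m) >> = b a m by rewrite /F liftU scale1r.
have F0 (y : {freeg (A * M)}) : tensor_rel y -> F y = 0.
  case: bal => bDl bDr bZ; elim=> {y} [|y z _ Fy _ Fz|a a' m|a m m'|a r m].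
  - exact: (raddf0 Fa).
  - by rewrite FB Fy Fz subr0.
  - by rewrite !FB !F1 bDl addrAC addrK subrr.
  - by rewrite !FB !F1 bDr addrAC addrK subrr.
  - by rewrite !FB !F1 bZ subrr.
apply/eqP; rewrite -subr_eq0 -FB; apply/eqP/F0/asboolP.
by have /eqmodP := reprK (\pi_(Quotient.quot tensor_ker) x).
Qed.

Lemma tensor_liftE a m : tensor_lift b (tens a m) = b a m.
Proof. by rewrite tensor_lift_pi liftU scale1r. Qed.

Lemma tensor_lift_is_zmod_morphism : zmod_morphism (tensor_lift b).
Proof.
elim/quotW=> x; elim/quotW=> y; rewrite -raddfB !tensor_lift_pi.
exact: (@lift_is_additive int (A * M)%type (zmodule Z)).
Qed.

End Lift.

End Tensor.

Definition tensor_map (R : nzRingType) (A B : lmodType R^c) (M : lmodType R)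
    (f : {linear A -> B}) : tensor A M -> tensor B M :=
  tensor_lift (fun a m => tens (f a) m).

Lemma tensor_map_balanced (R : nzRingType) (A B : lmodType R^c)
    (M : lmodType R) (f : {linear A -> B}) :
  balanced (fun (a : A) (m : M) => tens (f a) m).
Proof.
by case: (tens_balanced B M) => hl hr hz; split=> *;
  rewrite ?linearD ?linearZ /= ?hl ?hr ?hz.
Qed.

Lemma tensor_mapE (R : nzRingType) (A B : lmodType R^c) (M : lmodType R)
    (f : {linear A -> B}) (a : A) (m : M) :
  tensor_map f (tens a m) = tens (f a) m.
Proof. exact/tensor_liftE/tensor_map_balanced. Qed.

Definition flat (R : nzRingType) (M : lmodType R) : Prop :=
  forall (A B : lmodType R^c) (f : {linear A -> B}),
    injective f -> injective (@tensor_map R A B M f).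

Definition injective_module (R : nzRingType) (E : lmodType R) : Prop :=
  forall (A B : lmodType R) (f : {linear A -> B}) (g : {linear A -> E}),
    injective f -> exists h : {linear B -> E}, forall x, h (f x) = g x.

Definition surjective (A B : Type) (f : A -> B) : Prop :=
  forall y, exists x, f x = y.

Definition projective_module (R : nzRingType) (P : lmodType R) : Prop :=
  forall (B C : lmodType R) (p : {linear B -> C}) (g : {linear P -> C}),
    surjective p -> exists h : {linear P -> B}, forall x, p (h x) = g x.

Definition exact_at (R : nzRingType) (A B C : lmodType R)
    (f : {linear A -> B}) (g : {linear B -> C}) : Prop :=
  forall y, g y = 0 <-> exists x, f x = y.

(* Every nonzero submodule of E meets the image of f. *)
Definition essential_image (R : nzRingType) (A E : lmodType R)
    (f : {linear A -> E}) : Prop :=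
  forall S : set E, submodule S -> S <> [set 0] ->
    exists x : A, f x <> 0 /\ S (f x).

(* Minimality: each E_i is an injective hull of the preceding cosyzygy,
   which embeds in E_i as the image of the incoming map. *)
Record min_injective_resolution (R : nzRingType) (M : lmodType R) := {
  ires :> nat -> lmodType R;
  ires_aug : {linear M -> ires 0};
  ires_diff : forall i, {linear ires i -> ires i.+1};
  ires_injective : forall i, injective_module (ires i);
  ires_aug_inj : injective ires_aug;
  ires_exact0 : exact_at ires_aug (ires_diff 0);
  ires_exact : forall i, exact_at (ires_diff i) (ires_diff i.+1);
  ires_min0 : essential_image ires_aug;
  ires_min : forall i, essential_image (ires_diff i)
}.

Record projective_resolution (R : nzRingType) (M : lmodType R) := {
  pres :> nat -> lmodType R;
  pres_aug : {linear pres 0 -> M};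
  pres_diff : forall i, {linear pres i.+1 -> pres i};
  pres_projective : forall i, projective_module (pres i);
  pres_aug_surj : surjective pres_aug;
  pres_exact0 : exact_at (pres_diff 0) pres_aug;
  pres_exact : forall i, exact_at (pres_diff i.+1) (pres_diff i)
}.

Definition infinite_dominant_dimension (R : nzRingType) : Prop :=
  exists E : min_injective_resolution R^o, forall i, flat (E i).

Definition self_injective (R : nzRingType) : Prop := injective_module R^o.

Definition proj_dim_le (R : nzRingType) (M : lmodType R) (n : nat) : Prop :=
  exists P : projective_resolution M, forall i, (n < i)%N -> forall x : P i, x = 0.

Definition finite_proj_dim (R : nzRingType) (M : lmodType R) : Prop :=
  exists n, proj_dim_le M n.

Definition fin_dim_le (R : nzRingType) (n : nat) : Prop :=
  forall M : lmodType R,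
    fin_generated M -> finite_proj_dim M -> proj_dim_le M n.

(* fin.dim R = n: n is the least upper bound. *)
Definition fin_dim_eq (R : nzRingType) (n : nat) : Prop :=
  fin_dim_le R n /\ forall m, fin_dim_le R m -> (n <= m)%N.

(* Ext^j_R(M, N) = 0, where Ext^j_R(M, N) is the j-th cohomology of the complex
   Hom_R(P_0, N) -> Hom_R(P_1, N) -> ... for a projective resolution P of M:
   every j-cocycle is a j-coboundary. *)
Definition coboundary (R : nzRingType) (M N : lmodType R)
    (P : projective_resolution M) (j : nat) : {linear P j -> N} -> Prop :=
  match j with
  | 0 => fun f => forall x, f x = 0
  | i.+1 => fun f =>
      exists g : {linear P i -> N}, forall x, f x = g (pres_diff P i x)
  end.

Definition cocycle (R : nzRingType) (M N : lmodType R)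
    (P : projective_resolution M) (j : nat) (f : {linear P j -> N}) : Prop :=
  forall x, f (pres_diff P j x) = 0.

Definition Ext_eq0 (R : nzRingType) (j : nat) (M N : lmodType R) : Prop :=
  forall (P : projective_resolution M) (f : {linear P j -> N}),
    cocycle f -> coboundary f.

Definition grade_finite (R : nzRingType) (M : lmodType R) : Prop :=
  exists j, ~ Ext_eq0 j M R^o.

(* Main.v *)
(* Over an Artin algebra every finitely generated module has finite length, so
   a finitely generated submodule [K] of a flat module [E] is mapped into [E]
   through some [L^p].  If [E] is the injective hull of [L], at most length(L)
   coordinates already embed [K], which bounds the length of [K]; hence [E] is
   finitely generated and projective.  Therefore [fin.dim L = 0] splits
   [L -> E], whose cokernel has projective dimension at most 1.

   Dimension shifting along the minimal injective resolution shows that a simple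
   module of finite grade maps nontrivially to some [I'_i], hence embeds in [L].
   If all simple modules embed in [L], assign to a simple [S] the top of its
   injective hull inside [E].  By Fitting's argument this assignment is
   injective, so by the pigeonhole principle every simple module is a top
   of [E]: [E] is an injective generator and [L] is injective.  Conversely, if
   [L] is injective, the same relation read backwards shows that every simple
   module embeds in [L]. *)

Require Import Defs.
From HB Require Import structures.
From mathcomp Require Import all_boot all_algebra.
From mathcomp Require Import generic_quotient ring_quotient.
From mathcomp Require Import boolp classical_sets.

Set Implicit Arguments.
Unset Strict Implicit.
Unset Printing Implicit Defensive.

Import GRing.Theory.
Local Open Scope ring_scope.
Local Open Scope classical_set_scope.
Local Open Scope quotient_scope.

(** * Submodules, quotients and factorizations *)

(** A nonzero [x] in the right annihilator of a maximal left ideal [I] is the same as an embedding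
    of [L/I] into [L] sending the class of [1] to [x]; this links (3) and (4) to the statements on
    simple modules.

    For the hull [E], the obstacle is that flatness factors the inclusion of a finitely generated
    [K] through free modules of uncontrolled rank. Essentiality removes it: once [K] contains [L], a
    map on [K] is injective as soon as it is injective on [L], so the number of coordinates needed
    depends on [L] alone.

    The pigeonhole runs over isomorphism classes of simple modules. These are represented by maximal
    left ideals, with isomorphism expressed by a ring element ([cyclic_hom]), and counting is
    replaced by a descending chain of intersections.

    Reading the relation between socles and tops backwards requires two further facts: every simple
    module is the top of some hull inside [L], and the socle of a hull determines its top. The
    second rests on the endomorphism ring of a hull being local. *)

Section Submodules.
Variables (R : nzRingType) (M : lmodType R).
Implicit Types S T : set M.

Lemma submod0 S : submodule S -> S 0.
Proof. by case. Qed.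

Lemma submodD S x y : submodule S -> S x -> S y -> S (x + y).
Proof. by case=> _ h Sx Sy; rewrite -[x]scale1r; apply: h. Qed.

Lemma submodZ S r x : submodule S -> S x -> S (r *: x).
Proof. by case=> S0 h Sx; rewrite -[_ *: _]addr0; apply: h. Qed.

Lemma submodN S x : submodule S -> S x -> S (- x).
Proof. by move=> hS Sx; rewrite -scaleN1r; apply: submodZ. Qed.

Lemma submodB S x y : submodule S -> S x -> S y -> S (x - y).
Proof. by move=> hS Sx Sy; apply: submodD => //; apply: submodN. Qed.

Lemma submod_sum S (I : Type) (r : seq I) (F : I -> M) :
  submodule S -> (forall i, S (F i)) -> S (\sum_(i <- r) F i).
Proof.
move=> hS SF; elim: r => [|i r IH]; first by rewrite big_nil; apply: submod0.
by rewrite big_cons; apply: submodD.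
Qed.

Lemma submodDr S x y : submodule S -> S x -> S (x + y) -> S y.
Proof.
move=> hS Sx Sxy; have -> : y = (x + y) - x by rewrite addrC addKr.
exact: submodB.
Qed.

Lemma submodT : submodule [set: M].
Proof. by []. Qed.

Lemma submod_set0 : submodule [set (0 : M)].
Proof. by split=> // r x y -> ->; rewrite scaler0 addr0. Qed.

Lemma submodI S T : submodule S -> submodule T -> submodule (S `&` T).
Proof.
move=> [S0 hS] [T0 hT]; split; first by split.
by move=> r x y [Sx Tx] [Sy Ty]; split; [apply: hS|apply: hT].
Qed.

Lemma submod_bigI (I : Type) (P : I -> Prop) (F : I -> set M) :
  (forall i, P i -> submodule (F i)) -> submodule [set x | forall i, P i -> F i x].
Proof.
move=> hF; split=> [i Pi|r x y hx hy i Pi]; first exact: (hF i Pi).1.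
by apply: (hF i Pi).2; [apply: hx|apply: hy].
Qed.

Definition addset S T : set M := [set z | exists x y, [/\ S x, T y & z = x + y]].

Lemma submod_add S T : submodule S -> submodule T -> submodule (addset S T).
Proof.
move=> hS hT; split.
  by exists 0, 0; rewrite addr0; split=> //; apply: submod0.
move=> r _ _ [x [y [Sx Ty ->]]] [x' [y' [Sx' Ty' ->]]].
exists (r *: x + x'), (r *: y + y'); split; [exact: hS.2|exact: hT.2|].
by rewrite scalerDr addrACA.
Qed.

Lemma addset_subl S T : submodule T -> S `<=` addset S T.
Proof. by move=> hT x Sx; exists x, 0; split=> //; [apply: submod0|rewrite addr0]. Qed.

Lemma addset_subr S T : submodule S -> T `<=` addset S T.
Proof. by move=> hS x Tx; exists 0, x; split=> //; [apply: submod0|rewrite add0r]. Qed.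

Definition cyc (x : M) : set M := [set y | exists r, y = r *: x].

Lemma submod_cyc x : submodule (cyc x).
Proof.
split; first by exists 0; rewrite scale0r.
by move=> r _ _ [a ->] [b ->]; exists (r * a + b); rewrite scalerDl scalerA.
Qed.

Lemma cyc_id x : cyc x x.
Proof. by exists 1; rewrite scale1r. Qed.

Lemma cyc_sub S x : submodule S -> S x -> cyc x `<=` S.
Proof. by move=> hS Sx _ [r ->]; apply: submodZ. Qed.

Definition lspan n (e : 'I_n -> M) : set M :=
  [set x | exists c : 'I_n -> R, x = \sum_(i < n) c i *: e i].

Lemma submod_lspan n (e : 'I_n -> M) : submodule (lspan e).
Proof.
split; first by exists (fun=> 0); rewrite big1 // => i _; rewrite scale0r.
move=> r _ _ [c ->] [d ->]; exists (fun i => r * c i + d i).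
rewrite scaler_sumr -big_split; apply: eq_bigr => i _.
by rewrite scalerDl scalerA.
Qed.

Lemma lspan_mem n (e : 'I_n -> M) i : lspan e (e i).
Proof.
exists (fun j => (j == i)%:R); rewrite (bigD1 i) //= eqxx scale1r big1 ?addr0 //.
by move=> j /negbTE ->; rewrite scale0r.
Qed.

Lemma lspan_sub n (e : 'I_n -> M) S :
  submodule S -> (forall i, S (e i)) -> lspan e `<=` S.
Proof.
by move=> hS he _ [c ->]; apply: submod_sum => // i; apply: submodZ.
Qed.

End Submodules.

Section LinearMaps.
Variable R : nzRingType.
Implicit Types A B C M : lmodType R.

Definition mk_linear A B (f : A -> B) (hf : linear f) : {linear A -> B} :=
  HB.pack f (GRing.isLinear.Build R A B *:%R f hf).

Lemma mk_linearE A B (f : A -> B) (hf : linear f) x : mk_linear hf x = f x.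
Proof. by []. Qed.

Lemma submod_ker A B (f : {linear A -> B}) : submodule [set x | f x = 0].
Proof. by split=> /= [|r x y hx hy]; rewrite ?linear0 // linearP hx hy scaler0 addr0. Qed.

Lemma submod_preim A B (f : {linear A -> B}) (S : set B) :
  submodule S -> submodule [set x | S (f x)].
Proof.
move=> hS; split=> /= [|r x y hx hy]; first by rewrite linear0; apply: submod0.
by rewrite linearP; apply: hS.2.
Qed.

Lemma submod_im A B (f : {linear A -> B}) (S : set A) :
  submodule S -> submodule (f @` S).
Proof.
move=> hS; split; first by exists 0; rewrite ?linear0 //; apply: submod0.
move=> r _ _ [x Sx <-] [y Sy <-]; exists (r *: x + y); first exact: hS.2.
by rewrite linearP.
Qed.

Lemma submod_range A B (f : {linear A -> B}) : submodule (range f).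
Proof. exact: submod_im (submodT A). Qed.

Lemma ker0_inj A B (f : {linear A -> B}) :
  (forall x, f x = 0 -> x = 0) -> injective f.
Proof. by move=> h x y fxy; apply/subr0_eq/h; rewrite linearB fxy subrr. Qed.

End LinearMaps.

Section SubmoduleType.
Variables (R : nzRingType) (M : lmodType R) (S : set M) (hS : submodule S).

(** The proof of [submodule S] is an argument so that the closure instance below can be attached to
    the predicate. *)
Definition submod_pred of submodule S : {pred M} := fun x => `[< S x >].

Lemma submod_pred_closed : GRing.submod_closed (submod_pred hS).
Proof.
split; first exact/asboolP/(submod0 hS).
by move=> r x y /asboolP Sx /asboolP Sy; apply/asboolP/hS.2.
Qed.

HB.instance Definition _ :=
  GRing.isSubmodClosed.Build R M (submod_pred hS)
    submod_pred_closed.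

Record subm := Subm { subm_val : M; subm_valP : subm_val \in submod_pred hS }.
HB.instance Definition _ := [isSub for subm_val].
HB.instance Definition _ := [Choice of subm by <:].
HB.instance Definition _ := [SubChoice_isSubLmodule of subm by <:].

(** Later proofs see a submodule only through such an embedding; maps into it then come from
    [factor_inj]. *)
Lemma subm_exists : exists (N : lmodType R) (i : {linear N -> M}),
  injective i /\ forall x, S x <-> exists n, i n = x.
Proof.
exists subm, (val : subm -> M); split; first exact: val_inj.
move=> x; split=> [Sx|[n <-]]; last by apply/asboolP; apply: (valP n).
have hx : x \in submod_pred hS by apply/asboolP.
by exists (Subm hx).
Qed.

End SubmoduleType.

Section QuotientModule.
Variables (R : nzRingType) (M : lmodType R) (S : set M) (hS : submodule S).

Definition quom := Quotient.quot (submod_pred hS).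
HB.instance Definition _ := GRing.Zmodule.on quom.

Local Notation pi := (\pi_(Quotient.quot (submod_pred hS)) : M -> quom).

Lemma quom_piE (x y : M) : pi x = pi y <-> S (x - y).
Proof.
split=> [/eqmodP h|h]; first by apply/asboolP.
by apply/eqmodP/asboolP.
Qed.

Lemma quom_piD (x y : M) : pi (x + y) = pi x + pi y.
Proof. by rewrite -[LHS]/(\pi_(Quotient.quot (submod_pred hS)) (x + y)) raddfD. Qed.

Lemma quom_reprK (q : quom) : pi (repr (q : Quotient.quot (submod_pred hS))) = q.
Proof. exact: reprK. Qed.

Definition quom_scale (r : R) (q : quom) : quom :=
  pi (r *: repr (q : Quotient.quot (submod_pred hS))).

Lemma quom_scaleE r x : quom_scale r (pi x) = pi (r *: x).
Proof.
apply/quom_piE; rewrite -scalerBr; apply: submodZ => //.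
by apply/quom_piE; rewrite quom_reprK.
Qed.

Lemma quom_scaleA a b v : quom_scale a (quom_scale b v) = quom_scale (a * b) v.
Proof. by rewrite -(quom_reprK v) !quom_scaleE scalerA. Qed.
Lemma quom_scale1 : left_id 1 quom_scale.
Proof. by move=> v; rewrite -(quom_reprK v) !quom_scaleE scale1r. Qed.
Lemma quom_scaleDr : right_distributive quom_scale +%R.
Proof.
move=> r u v; rewrite -(quom_reprK u) -(quom_reprK v).
by rewrite -quom_piD !quom_scaleE -quom_piD scalerDr.
Qed.
Lemma quom_scaleDl v : {morph quom_scale^~ v : a b / a + b}.
Proof.
move=> a b; rewrite -(quom_reprK v) /= !quom_scaleE -quom_piD.
by rewrite scalerDl.
Qed.

HB.instance Definition _ := GRing.Zmodule_isLmodule.Build R quom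
  quom_scaleA quom_scale1 quom_scaleDr quom_scaleDl.

Lemma quom_pi_linear : linear pi.
Proof. by move=> r x y; rewrite quom_piD -quom_scaleE. Qed.

Lemma quom_exists : exists (Q : lmodType R) (p : {linear M -> Q}),
  surjective p /\ forall x, p x = 0 <-> S x.
Proof.
exists quom, (mk_linear quom_pi_linear); split=> [q|x].
  by exists (repr (q : Quotient.quot (submod_pred hS))); exact: quom_reprK.
have p0 : mk_linear quom_pi_linear 0 = 0 by exact: linear0.
by rewrite -p0 -[_ = _]/(pi x = pi 0) quom_piE subr0.
Qed.

End QuotientModule.

Section Factor.
Variable R : nzRingType.
Implicit Types A B C E P : lmodType R.

Lemma factor_surj A B C (p : {linear A -> B}) (g : {linear A -> C}) :
  surjective p -> (forall x, p x = 0 -> g x = 0) ->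
  exists h : {linear B -> C}, forall x, h (p x) = g x.
Proof.
move=> /choice [s ps] pg.
have gE x y : p x = p y -> g x = g y.
  by move=> e; apply/subr0_eq; rewrite -linearB pg // linearB e subrr.
have hl : linear (fun b => g (s b)).
  by move=> r x y; rewrite -linearP; apply: gE; rewrite linearP !ps.
by exists (mk_linear hl) => x; apply: gE; rewrite ps.
Qed.

Lemma factor_inj A B C (i : {linear B -> C}) (g : {linear A -> C}) :
  injective i -> (forall x, exists y, i y = g x) ->
  exists h : {linear A -> B}, forall x, i (h x) = g x.
Proof.
move=> inj_i /choice [s hs].
have hl : linear s by move=> r x y; apply: inj_i; rewrite linearP !hs linearP.
by exists (mk_linear hl) => x; apply: hs.
Qed.

(** Here [d] may have a kernel: [g] factors through the image of [d], and injectivity is applied to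
    the inclusion of that image. The same detour through an image gives [projective_lift]. *)
Lemma injective_ext E A B (d : {linear A -> B}) (g : {linear A -> E}) :
  injective_module E -> (forall x, d x = 0 -> g x = 0) ->
  exists h : {linear B -> E}, forall x, h (d x) = g x.
Proof.
move=> injE dg.
have [N [i [inj_i iP]]] := subm_exists (submod_range d).
have [d' d'E] : exists d' : {linear A -> N}, forall x, i (d' x) = d x.
  by apply: factor_inj => // x; apply/iP; exists x.
have [g' g'E] : exists g' : {linear N -> E}, forall x, g' (d' x) = g x.
  apply: factor_surj => [n|x d'x]; last by apply: dg; rewrite -d'E d'x linear0.
  have [x _ dx] : range d (i n) by apply/iP; exists n.
  by exists x; apply: inj_i; rewrite d'E.
have [h hE] := injE _ _ i g' inj_i.
by exists h => x; rewrite -d'E hE g'E.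
Qed.

Lemma projective_lift P B C (p : {linear B -> C}) (g : {linear P -> C}) :
  projective_module P -> (forall x, exists y, p y = g x) ->
  exists h : {linear P -> B}, forall x, p (h x) = g x.
Proof.
move=> projP gp.
have [N [i [inj_i iP]]] := subm_exists (submod_range p).
have [p' p'E] : exists p' : {linear B -> N}, forall x, i (p' x) = p x.
  by apply: factor_inj => // x; apply/iP; exists x.
have [g' g'E] : exists g' : {linear P -> N}, forall x, i (g' x) = g x.
  by apply: factor_inj => // x; apply/iP; have [y <-] := gp x; exists y.
have [|h hE] := projP _ _ p' g'.
  move=> n; have [x _ px] : range p (i n) by apply/iP; exists n.
  by exists x; apply: inj_i; rewrite p'E.
by exists h => x; rewrite -p'E hE g'E.
Qed.

End Factor.

(** * Finite length *)

Section FiniteLength.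
Variable R : nzRingType.

(** Ranking an interval of submodules stands for the length of [B/A], so extensions can be treated
    without forming quotients. *)
Definition rank_between (M : lmodType R) (A B : set M) (rk : set M -> nat) :=
  forall S T : set M, submodule S -> submodule T ->
    A `<=` S -> S `<=` T -> T `<=` B -> ~ (T `<=` S) -> (rk S < rk T)%N.

(* Finite length: a strictly monotone rank on submodules exists. *)
Definition finlen (M : lmodType R) : Prop :=
  exists rk : set M -> nat, rank_between [set 0] [set: M] rk.

Section Module.
Variable M : lmodType R.
Implicit Types A B C S T : set M.

Lemma rank_leq A B rk S T : rank_between A B rk -> submodule S -> submodule T ->
  A `<=` S -> S `<=` T -> T `<=` B -> (rk S <= rk T)%N.
Proof.
move=> hrk hS hT AS ST TB; have [TS|nTS] := pselect (T `<=` S).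
  by rewrite (_ : S = T) // eqEsubset.
exact/ltnW/hrk.
Qed.

(* By the modular law a strict inclusion [S < T] is still strict either after
   intersecting with [B] or after adding [B]. *)
Lemma rank_trans A B C rk1 rk2 : submodule B -> A `<=` B -> B `<=` C ->
  submodule C ->
  rank_between A B rk1 -> rank_between B C rk2 ->
  rank_between A C (fun S => rk1 (S `&` B) + rk2 (addset S B))%N.
Proof.
move=> hB AB BC hC h1 h2 S T hS hT AS ST TC nTS.
have IS : S `&` B `<=` T `&` B by move=> x [/ST].
have DS : addset S B `<=` addset T B.
  by move=> _ [x [y [/ST Tx By ->]]]; exists x, y.
have DC : addset T B `<=` C.
  by move=> _ [x [y [/TC Cx /BC Cy ->]]]; apply: submodD.
have hI := submodI; have hD := submod_add.
have [IT|nIT] := pselect (T `&` B `<=` S `&` B).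
  rewrite -addnS leq_add //.
    by apply: (rank_leq h1); auto => x Ax; split; [apply: AS|apply: AB].
  apply: h2; auto; first exact: addset_subr.
  move=> DT; apply: nTS => t Tt.
  have [|s [b [Ss Bb tE]]] := DT t; first exact: addset_subl.
  have [|Sb _] := IT b; last by rewrite tE; apply: submodD.
  by split=> //; apply: (submodDr hT (ST _ Ss)); rewrite -tE.
rewrite -addSn leq_add //.
  by apply: h1; auto => x Ax; split; [apply: AS|apply: AB].
by apply: (rank_leq h2); auto; apply: addset_subr.
Qed.

Lemma finlen_max (P : set M -> Prop) S0 : finlen M -> submodule S0 -> P S0 ->
  exists S, [/\ submodule S, P S & forall T, submodule T -> P T -> S `<=` T -> T `<=` S].
Proof.
move=> [rk hrk]; have rkT S : submodule S -> (rk S <= rk setT)%N.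
  by move=> hS; apply: (rank_leq hrk) => //= _ ->; apply: submod0.
have [n] := ubnP (rk setT - rk S0)%N.
elim: n S0 => // n IHn S0 hn hS0 PS0.
have [h|] := pselect (forall T, submodule T -> P T -> S0 `<=` T -> T `<=` S0).
  by exists S0.
move=> /existsNP[T /not_implyP[hT /not_implyP[PT /not_implyP[S0T nTS0]]]].
have lt : (rk S0 < rk T)%N by apply: hrk => //= _ ->; apply: submod0.
apply: (IHn T) => //; rewrite ltnS in hn; apply: leq_trans hn.
by rewrite ltn_sub2l //; apply: leq_trans lt (rkT _ hT).
Qed.

Lemma finlen_min (P : set M -> Prop) S0 : finlen M -> submodule S0 -> P S0 ->
  exists S, [/\ submodule S, P S & forall T, submodule T -> P T -> T `<=` S -> S `<=` T].
Proof.
move=> [rk hrk]; have [n] := ubnP (rk S0); elim: n S0 => // n IHn S0 hn hS0 PS0.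
have [h|] := pselect (forall T, submodule T -> P T -> T `<=` S0 -> S0 `<=` T).
  by exists S0.
move=> /existsNP[T /not_implyP[hT /not_implyP[PT /not_implyP[TS0 nS0T]]]].
rewrite ltnS in hn; apply: (IHn T) => //; apply: leq_trans hn.
by apply: hrk => //= _ ->; apply: submod0.
Qed.

Lemma lspan_recr n (e : 'I_n.+1 -> M) :
  lspan e = addset (lspan (fun i : 'I_n => e (widen_ord (leqnSn n) i)))
                  (cyc (e ord_max)).
Proof.
apply/seteqP; split=> [_ [c ->]|].
  rewrite big_ord_recr /=; do 2 eexists; split; [| |reflexivity].
    by exists (fun i => c (widen_ord (leqnSn n) i)).
  by exists (c ord_max).
move=> _ [x [y [Sx Cy ->]]]; apply: submodD; first exact: submod_lspan.
  by apply: lspan_sub Sx; [exact: submod_lspan|move=> i; apply: lspan_mem].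
by apply: cyc_sub Cy; [exact: submod_lspan|apply: lspan_mem].
Qed.

(** The quotient of [A + Rx] by [A] is cyclic, so its submodules correspond to left ideals of [R],
    whose rank is pulled back along [r |-> r *: x]. *)
Lemma rank_cyc A (x : M) rk : submodule A -> @rank_between R^o [set 0] setT rk ->
  rank_between A (addset A (cyc x)) (fun S => rk [set r | S (r *: x)]).
Proof.
move=> hA hrk S T hS hT AS ST TB nTS.
have hp U : submodule U -> @submodule R R^o [set r | U (r *: x)].
  move=> hU; split=> /= [|r a b]; first by rewrite scale0r; apply: submod0.
  by rewrite scalerDl -scalerA => Ua Ub; apply: hU.2.
apply: hrk => //; [exact: hp|exact: hp|by move=> _ ->; apply: (submod0 (hp _ hS))
  |by move=> r /ST|].
move=> h; apply: nTS => t Tt; have [a [_ [Aa [r ->] tE]]] := TB _ Tt.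
rewrite tE; apply: submodD => //; first exact: AS.
by apply: h; apply: (submodDr hT (ST _ (AS _ Aa))); rewrite -tE.
Qed.

Lemma finlen_lspan n (e : 'I_n -> M) : finlen R^o ->
  exists rk, rank_between [set 0] (lspan e) rk.
Proof.
move=> [rk hrk]; elim: n e => [|n IHn] e.
  exists (fun=> 0%N) => S T hS hT S0 ST TB nTS; case: nTS => t /TB[c ->].
  by rewrite big_ord0; apply: submod0.
have [rk1 h1] := IHn (fun i : 'I_n => e (widen_ord (leqnSn n) i)).
have h2 := @rank_cyc _ (e ord_max) _ (submod_lspan (fun i : 'I_n => e (widen_ord (leqnSn n) i))) hrk.
rewrite lspan_recr; eexists; apply: rank_trans h1 h2.
- exact: submod_lspan.
- by move=> _ ->; apply: submod0; apply: submod_lspan.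
- by apply: addset_subl; apply: submod_cyc.
- by apply: submod_add; [apply: submod_lspan|apply: submod_cyc].
Qed.

Lemma finlen_fin_generated : finlen R^o -> fin_generated M -> finlen M.
Proof.
move=> hR [n [e he]]; have [rk hrk] := finlen_lspan e hR.
exists rk; rewrite (_ : setT = lspan e) //.
by apply/seteqP; split=> // x _; apply: he.
Qed.

Lemma lspan_rcons n (e : 'I_n -> M) x :
  exists e' : 'I_n.+1 -> M, lspan e' = addset (lspan e) (cyc x).
Proof.
pose e' i := oapp e x (unlift (@ord_max n) i).
have e'w : (fun i : 'I_n => e' (widen_ord (leqnSn n) i)) = e.
  apply/funext => i; rewrite /e'.
  have -> : widen_ord (leqnSn n) i = lift ord_max i.
    by apply: val_inj; rewrite /= /bump leqNgt ltn_ord add0n.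
  by rewrite liftK.
by exists e'; rewrite lspan_recr e'w /e' unlift_none.
Qed.

(** A finitely generated submodule of [S] that is maximal among such must be all of [S], since
    adjoining one more element keeps it finitely generated. *)
Lemma finlen_submod_lspan S : finlen M -> submodule S ->
  exists n (e : 'I_n -> M), S = lspan e.
Proof.
move=> hM hS.
pose P T := T `<=` S /\ exists n (e : 'I_n -> M), T = lspan e.
have [||T [_ [TS [n [e TE]]] Tmax]] := @finlen_max P (lspan (fun i : 'I_0 => 0)) hM.
- exact: submod_lspan.
- split; last by exists 0%N, (fun=> 0).
  by apply: lspan_sub => // i; apply: submod0.
exists n, e; rewrite -TE; apply/seteqP; split=> // x Sx.
have [e' e'E] := lspan_rcons e x; apply: (Tmax (lspan e')).
- exact: submod_lspan.
- split; last by exists n.+1, e'.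
  rewrite e'E -TE => _ [y [z [Ty Cz ->]]]; apply: submodD => //; first exact: TS.
  exact: cyc_sub Cz.
- by rewrite e'E -TE; apply: addset_subl; apply: submod_cyc.
- by rewrite e'E -TE; apply: addset_subr (cyc_id x); rewrite TE; apply: submod_lspan.
Qed.

(** Zorn's lemma is used instead of [finlen_max] because this is applied to a commutative Artinian
    ring before its finite length is known. *)
Lemma max_avoiding (N : set M) (x : M) : submodule N -> ~ N x ->
  exists N', [/\ submodule N', N `<=` N', ~ N' x &
    forall T, submodule T -> N' `<=` T -> ~ T x -> T `<=` N'].
Proof.
move=> hN Nx.
(* The empty set is let through because [Zorn_bigcup] also asks for the union of the empty chain. *)
pose P (T : set M) := T !=set0 -> [/\ submodule T, N `<=` T & ~ T x].
have [F FP totF|N' [PN' maxN']] := @Zorn_bigcup M P.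
  move=> [y [S FS Sy]]; have Sne : S !=set0 by exists y.
  have [hS NS _] := FP _ FS Sne.
  split.
  - split; first by exists S => //; apply: submod0.
    move=> r a b [U FU Ua] [V FV Vb].
    have [hU _ _] := FP _ FU (ex_intro _ _ Ua).
    have [hV _ _] := FP _ FV (ex_intro _ _ Vb).
    have [UV|VU] := totF _ _ FU FV.
      by exists V => //; apply: hV.2 => //; apply: UV.
    by exists U => //; apply: hU.2 => //; apply: VU.
  - by move=> z Nz; exists S => //; apply: NS.
  - by move=> [U FU Ux]; have [_ _] := FP _ FU (ex_intro _ _ Ux).
have N'ne : N' !=set0.
  apply: contrapT => h; have N'0 : N' = set0 by apply: contrapT => /eqP/set0P.
  apply: (maxN' N) => [|_]; last by split.
  by rewrite N'0; split; [exact: sub0set|move=> /(_ 0 (submod0 hN))].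
have [hN' NN' N'x] := PN' N'ne; exists N'; split=> // T hT N'T Tx y Ty.
apply: contrapT => nN'y; apply: (maxN' T) => [|_].
  by split=> // TN'; apply/nN'y/TN'.
by split=> //; apply: subset_trans N'T.
Qed.

End Module.
End FiniteLength.

Lemma finlen_inj (R : nzRingType) (A B : lmodType R) (f : {linear A -> B}) :
  injective f -> finlen B -> finlen A.
Proof.
move=> inj_f [rk hrk]; exists (fun S => rk (f @` S)) => S T hS hT _ ST _ nTS.
apply: hrk; [exact: submod_im|exact: submod_im| |exact: image_subset|by []|].
  by move=> _ ->; apply: submod0; apply: submod_im.
move=> h; apply: nTS => t Tt; have [|s Ss] := h (f t); first by exists t.
by move=> /inj_f <-.
Qed.

(** * Finite length of commutative Artinian rings *)

Section ArtinianCommutative.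
Variable k : comNzRingType.
Local Notation K := (k^o : lmodType k).

Lemma artinian_min (P : set K -> Prop) (S0 : set K) : artinian_comring k ->
  submodule S0 -> P S0 ->
  exists S, [/\ submodule S, P S & forall T, submodule T -> P T -> T `<=` S -> S `<=` T].
Proof.
move=> artin hS0 PS0; apply: contrapT => nomin.
pose X := {S : set K | submodule S /\ P S}.
have step (s : X) : exists t : X, sval t `<=` sval s /\ ~ (sval s `<=` sval t).
  case: s => S [hS PS] /=; apply: contrapT => h; apply: nomin; exists S.
  split=> // T hT PT TS; apply: contrapT => ST; apply: h.
  by exists (exist _ T (conj hT PT)).
have [f hf] := choice step.
pose s n := iter n f (exist _ S0 (conj hS0 PS0)).
have [|n|N hN] := artin (fun n => sval (s n)).
- by move=> n; case: (svalP (s n)).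
- by have [] := hf (s n).
- have [_] := hf (s N); apply; have /= := hN N.+1 (leqnSn N).
  by rewrite -/(s N) => <-.
Qed.

(* Among the ideals of finite colength a minimal one [W] must vanish: otherwise
   [m W <> W] for some maximal ideal [m], and [W] has a maximal submodule. *)
Lemma artinian_finlen : artinian_comring k -> finlen K.
Proof.
move=> artin; pose P (S : set K) := exists rk, rank_between S setT rk.
have PT : P setT by exists (fun=> 0%N) => S T _ _ TS _ _ []; apply: subset_trans TS.
have [W [hW [rk hrk] Wmin]] := artinian_min artin (submodT K) PT.
suff W0 : W `<=` [set 0].
  exists rk => S T hS hT _; apply: hrk => // x /W0 ->; exact: submod0.
move=> x0 Wx0; apply: contrapT => /eqP x0N0.
(* [Q A] says that the product [A W] is nonzero. If [W] were contained in [m W], minimality of [A]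
   would give [a = a y] with [y] in [m]; then [1 - y] annihilates [a], hence lies in [m], and so
   does [1]. *)
pose Q (A : set K) := exists a w, [/\ A a, W w & a * w != 0 :> k].
have [|A [hA [a [w [Aa Ww aw0]]] Amin]] := @artinian_min Q setT artin (submodT K).
  by exists 1, x0; rewrite mul1r.
pose Ann : set K := [set r : k | r * a = 0].
have hAnn : submodule Ann.
  split=> [|r x y] /=; first by rewrite /Ann /= mul0r.
  by rewrite /Ann /= mulrDl -[r *: x]/(r * x) -mulrA => -> ->; rewrite mulr0 addr0.
have Ann1 : ~ Ann 1.
  by rewrite /Ann /= mul1r => a0; rewrite a0 mul0r eqxx in aw0.
have [m [hm Annm m1 mmax]] := max_avoiding hAnn Ann1.
have minv (c : k) : ~ m c -> exists d : k, m (1 - d * c).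
  move=> mc; have [[x [_ [mx [d ->] E]]]|n1] := pselect (addset m (cyc (c : K)) 1).
    by exists d; rewrite E addrK.
  case: mc; apply: (mmax _ _ _ n1); first by apply: submod_add => //; apply: submod_cyc.
    by apply: addset_subl; apply: submod_cyc.
  by apply: addset_subr => //; apply: cyc_id.
pose mW : set K := [set x | forall T : set K,
  submodule T /\ (forall (u : k) (v : K), m u -> W v -> T (u *: v)) -> T x].
have hmW : submodule mW.
  by apply: (@submod_bigI _ _ _ _ (fun T => T)) => T [].
have mWin (u : k) (v : K) : m u -> W v -> mW (u *: v).
  by move=> mu Wv T [_]; apply.
have [WmW|/existsNP[x /not_implyP[Wx mWx]]] := pselect (W `<=` mW).
  have [u [v [mu Wv auv]]] : exists u v : k, [/\ m u, W v & a * (u * v) != 0].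
    apply: contrapT => h; move/eqP: aw0; apply.
    apply: (WmW _ Ww [set y : K | a * y = 0]); split=> [|u v mu Wv /=].
      split=> [|r y z] /=; first by rewrite mulr0.
      by rewrite mulrDr -[r *: y]/(r * y) mulrCA => -> ->; rewrite mulr0 addr0.
    by apply: contrapT => /eqP auv; apply: h; exists u, v.
  pose B : set K := [set r : k | exists2 v, m v & r = a * v].
  have hB : submodule B.
    split; first by exists 0; rewrite ?mulr0 //; apply: submod0.
    move=> r _ _ [y my ->] [z mz ->]; exists (r *: y + z); first exact: hm.2.
    by rewrite mulrDr -[r *: y]/(r * y) mulrCA.
  have [||y my aE] := Amin B hB _ _ a Aa.
  - by exists (a * u), v; split=> //; [exists u|rewrite -mulrA].
  - by move=> _ [y my ->]; rewrite mulrC; apply: submodZ.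
  - apply: m1; rewrite -[1](subrK y); apply: submodD => //; apply: Annm.
    by rewrite /Ann /= mulrBl mul1r mulrC -aE subrr.
have [W' [hW' mWW' W'x W'max]] := max_avoiding hmW mWx.
have hI := submodI hW' hW.
have W'in y : W y -> ~ W' y -> exists2 w' : K, W' w' & exists r : k, x = w' + r *: y.
  move=> Wy W'y; apply: contrapT => h; apply: W'y.
  have hadd : submodule (addset W' (cyc y)) by apply: submod_add => //; apply: submod_cyc.
  apply: (W'max _ hadd); first by apply: addset_subl; apply: submod_cyc.
    by move=> [w' [_ [W'w' [r ->] E]]]; apply: h; exists w' => //; exists r.
  by apply: addset_subr => //; apply: cyc_id.
(* The quotient of [W] by its intersection with [W'] is simple: a larger submodule contains [x], and
   [x] recovers every [y] of [W] because elements outside [m] are invertible modulo [m]. A rank with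
   values 0 and 1 is therefore enough, and the intersection contradicts the minimality of [W]. *)
have rk1 : rank_between (W' `&` W) W (fun S => `[< W `<=` S >] : nat).
  move=> S T hS hT IS ST TW nTS.
  have -> : `[< W `<=` S >] = false.
    by apply/asboolPn => WS; apply: nTS; apply: subset_trans WS.
  suff WT : W `<=` T by rewrite asboolT.
  have IT := subset_trans IS ST.
  move: nTS => /existsNP[t /not_implyP[Tt St]].
  have W't : ~ W' t by move=> W't; apply/St/IS; split=> //; apply: TW.
  have Tx : T x.
    have [w' W'w' [r xE]] := W'in t (TW _ Tt) W't.
    have Ww' : W w'.
      have -> : w' = x - r *: t by rewrite xE addrK.
      by apply: submodB => //; apply: submodZ => //; apply: TW.
    by rewrite xE; apply: submodD => //; [apply: IT|apply: submodZ].
  move=> y Wy; have [W'y|W'y] := pselect (W' y); first exact: IT.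
  have [w' W'w' [r xE]] := W'in y Wy W'y.
  have Ww' : W w'.
    have -> : w' = x - r *: y by rewrite xE addrK.
    by apply: submodB => //; apply: submodZ.
  have [|d md] := minv r.
    by move=> mr; apply: W'x; rewrite xE; apply: submodD => //; apply: mWW'; apply: mWin.
  have -> : y = (1 - d * r) *: y + d *: (x - w').
    by rewrite xE addrAC subrr add0r scalerA -scalerDl subrK scale1r.
  apply: submodD => //.
    by apply: IT; split; [apply: mWW'; apply: mWin|apply: submodZ].
  by apply: submodZ => //; apply: submodB => //; apply: IT.
have := @Wmin (W' `&` W) hI _ (@subIsetr _ _ _) x Wx.
case=> [|//]; eexists.
exact: (rank_trans hW (@subIsetr _ _ _) (@subsetT _ _) (submodT K) rk1 hrk).
Qed.

End ArtinianCommutative.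

(** Scalars of [k] act through [L], so left ideals of [L] are [k]-submodules and the rank over [k]
    restricts to them. *)
Lemma artin_algebra_finlen (k : comNzRingType) (L : algType k) :
  artin_algebra L -> @finlen L L^o.
Proof.
move=> [/artinian_finlen hk /(finlen_fin_generated hk) [rk hrk]].
exists rk => S T hS hT; apply: hrk.
  split=> [|r x y Sx Sy]; first exact: (submod0 hS).
  by rewrite -mulr_algl; apply: hS.2.
split=> [|r x y Sx Sy]; first exact: (submod0 hT).
by rewrite -mulr_algl; apply: hT.2.
Qed.

(** * Free modules and resolutions *)

Section FreeModules.
Variable R : nzRingType.
Implicit Types (A B M N P Q E : lmodType R) (n : nat).

Definition freem n : lmodType R := {ffun 'I_n -> R^o}.

Definition basis_vec n (i : 'I_n) : freem n := [ffun j => (j == i)%:R].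

Lemma freemE n (c : freem n) : c = \sum_(i < n) (c i : R) *: basis_vec i.
Proof.
apply/ffunP => j; rewrite sum_ffunE (bigD1 j) //= big1 => [|i /negbTE ij].
  by rewrite !ffunE eqxx addr0 -[_ *: _]/(_ * _) mulr1.
by rewrite !ffunE eq_sym ij scaler0.
Qed.

Lemma free_map_linear n M (e : 'I_n -> M) :
  linear (fun c : freem n => \sum_(i < n) (c i : R) *: e i).
Proof.
move=> r x y; rewrite scaler_sumr -big_split; apply: eq_bigr => i _ /=.
by rewrite !ffunE scalerDl scalerA.
Qed.

Definition free_map n M (e : 'I_n -> M) : {linear freem n -> M} :=
  mk_linear (free_map_linear e).

Lemma free_mapE n M (e : 'I_n -> M) c :
  free_map e c = \sum_(i < n) (c i : R) *: e i.
Proof. by []. Qed.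

Lemma linear_free n M (f : {linear freem n -> M}) c :
  f c = \sum_(i < n) (c i : R) *: f (basis_vec i).
Proof.
by rewrite {1}(freemE c) linear_sum; apply: eq_bigr => i _; rewrite linearZ.
Qed.

Lemma projective_free n : projective_module (freem n).
Proof.
move=> B C p g /choice [s ps]; exists (free_map (fun i => s (g (basis_vec i)))) => x.
rewrite [RHS]linear_free free_mapE linear_sum; apply: eq_bigr => i _.
by rewrite linearZ /= ps.
Qed.

Lemma projective_regular : projective_module (R^o : lmodType R).
Proof.
move=> B C p g surj_p; have [y py] := surj_p (g 1).
have hl : linear (fun r : R^o => (r : R) *: y).
  by move=> r a b; rewrite scalerDl scalerA.
exists (mk_linear hl) => x; rewrite -[mk_linear hl x]/((x : R) *: y) linearZ /= py.
by rewrite -linearZ -[_ *: 1]/(x * 1) mulr1.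
Qed.

Lemma projective_retract P Q (s : {linear P -> Q}) (r : {linear Q -> P}) :
  (forall x, r (s x) = x) -> projective_module Q -> projective_module P.
Proof.
move=> rs projQ B C p g surj_p.
have [h hE] := projQ _ _ p (g \o r : {linear Q -> C}) surj_p.
by exists (h \o s : {linear P -> B}) => x; rewrite /= hE /= rs.
Qed.

Lemma injective_free n : self_injective R -> injective_module (freem n).
Proof.
move=> injR A B f g inj_f.
have coordl (i : 'I_n) : linear (fun x => g x i : R^o).
  by move=> r x y; rewrite linearP !ffunE.
have /choice [h hE] : forall i : 'I_n, exists h : {linear B -> R^o},
    forall x, h (f x) = g x i.
  by move=> i; have [h hE] := injR _ _ f (mk_linear (coordl i)) inj_f; exists h.
have hl : linear (fun b => [ffun i => h i b] : freem n).
  by move=> r x y; apply/ffunP => i; rewrite !ffunE linearP.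
exists (mk_linear hl) => x; apply/ffunP => i.
by rewrite -hE mk_linearE ffunE.
Qed.

Lemma fin_generated_cover M :
  fin_generated M <-> exists n (p : {linear freem n -> M}), surjective p.
Proof.
split=> [[n [e he]]|[n [p surj_p]]].
  exists n, (free_map e) => x; have [c ->] := he x.
  by exists [ffun i => c i]; apply: eq_bigr => i _; rewrite ffunE.
exists n, (fun i => p (basis_vec i)) => x; have [c <-] := surj_p x.
by exists c; apply: linear_free.
Qed.

Lemma fin_generated_free n : fin_generated (freem n).
Proof. by apply/fin_generated_cover; exists n, idfun => x; exists x. Qed.

Lemma fin_generated_regular : fin_generated (R^o : lmodType R).
Proof.
by exists 1%N, (fun=> 1) => x; exists (fun=> x); rewrite big_ord1 -[RHS]/(x * 1) mulr1.
Qed.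

Lemma fin_generated_image A B (f : {linear A -> B}) :
  surjective f -> fin_generated A -> fin_generated B.
Proof.
move=> surj_f /fin_generated_cover [n [p surj_p]]; apply/fin_generated_cover.
exists n, (f \o p : {linear freem n -> B}) => y.
by have [x <-] := surj_f y; have [z <-] := surj_p x; exists z.
Qed.

Lemma finlen_sub_fin_generated N M (i : {linear N -> M}) :
  finlen M -> injective i -> fin_generated N.
Proof.
move=> hM inj_i; have hN := finlen_inj inj_i hM.
have [n [e eE]] := finlen_submod_lspan hN (submodT N).
by exists n, e => x; have : lspan e x by rewrite -eE.
Qed.

Definition zerom : lmodType R := freem 0.

Lemma zerom_eq0 (x : zerom) : x = 0.
Proof. by apply/ffunP => -[]. Qed.

Definition zero_map A B : {linear A -> B} := \0.

Section ShortResolution.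
Variables (A B M : lmodType R) (i : {linear A -> B}) (p : {linear B -> M}).
Hypotheses (projA : projective_module A) (projB : projective_module B).
Hypotheses (inj_i : injective i) (surj_p : surjective p) (ip : exact_at i p).

Definition short_pres (n : nat) : lmodType R :=
  match n with 0 => B | 1 => A | _ => zerom end.

Definition short_diff n : {linear short_pres n.+1 -> short_pres n} :=
  match n with 0 => i | m.+1 => zero_map _ _ end.

Lemma proj_dim_le1 : proj_dim_le M 1.
Proof.
have projn n : projective_module (short_pres n).
  by case: n => [|[|n]] //; apply: projective_free.
have exn n : exact_at (short_diff n.+1) (short_diff n).
  case: n => [|n] y /=; split.
  - by move=> iy0; exists 0; apply: inj_i; rewrite iy0 linear0.
  - by move=> [x <-]; rewrite linear0.
  - by case: n y => [|n] y _; exists 0; rewrite [RHS]zerom_eq0.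
  - by [].
exists (@Build_projective_resolution R M short_pres p short_diff projn surj_p ip exn).
by case=> [|[|n]] // _ x; apply: zerom_eq0.
Qed.

End ShortResolution.

Lemma proj_dim_le0P M : proj_dim_le M 0 <-> projective_module M.
Proof.
split=> [[P P0]|projM].
  have aug_inj : injective (pres_aug P).
    apply: ker0_inj => x /pres_exact0 [y <-].
    by rewrite (P0 1%N isT y) linear0.
  have [|s sE] := @factor_inj R M (P 0%N) M (pres_aug P) idfun aug_inj.
    by move=> x; apply: pres_aug_surj.
  apply: (@projective_retract M (P 0%N) s (pres_aug P)) => [x|]; first exact: sE.
  exact: pres_projective.
pose d n : {linear (match n.+1 with 0 => M | _ => zerom end : lmodType R) ->
  (match n with 0 => M | _ => zerom end : lmodType R)} := zero_map _ _.
pose P n : lmodType R := match n with 0 => M | _ => zerom end.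
have projn n : projective_module (P n).
  by case: n => [|n] //; apply: projective_free.
have surj1 : surjective (idfun : {linear M -> M}) by move=> x; exists x.
have ex0 : exact_at (d 0%N) (idfun : {linear M -> M}).
  by move=> y; split=> [/= ->|[x <-]] //; exists 0.
have exn n : exact_at (d n.+1) (d n).
  by move=> y; split=> // _; exists 0; rewrite [RHS]zerom_eq0.
exists (@Build_projective_resolution R M P idfun d projn surj1 ex0 exn).
by case=> [|n] // _ x; apply: zerom_eq0.
Qed.

Section FreeResolution.
Hypothesis finR : @finlen R R^o.

(** The kernel is kept together with a proof that it is finitely generated, so that the construction
    can be iterated into a resolution. *)
Record free_cover M := Cover {
  cov_n : nat;
  cov_p : {linear freem cov_n -> M};
  cov_surj : surjective cov_p;
  cov_ker : lmodType R;
  cov_fg : fin_generated cov_ker;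
  cov_i : {linear cov_ker -> freem cov_n};
  cov_inj : injective cov_i;
  cov_exact : exact_at cov_i cov_p
}.

Lemma finlen_free n : finlen (freem n).
Proof. exact: finlen_fin_generated (fin_generated_free n). Qed.

Lemma cover_exists M : fin_generated M -> exists c : free_cover M, True.
Proof.
move=> /fin_generated_cover [n [p surj_p]].
have [N [i [inj_i iP]]] := subm_exists (submod_ker p).
have fgN := finlen_sub_fin_generated (finlen_free n) inj_i.
by exists (@Cover M n p surj_p N fgN i inj_i iP).
Qed.

Definition fgm := {M : lmodType R & fin_generated M}.

Definition fgm_cover (X : fgm) : free_cover (projT1 X) :=
  projT1 (cid (cover_exists (projT2 X))).

Definition fgm_ker (X : fgm) : fgm :=
  existT _ (cov_ker (fgm_cover X)) (cov_fg (fgm_cover X)).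

(** [Ext_eq0] quantifies over all projective resolutions, so refuting it requires that one
    exists. *)
Lemma free_resolution M : fin_generated M ->
  exists P : projective_resolution M, True.
Proof.
move=> fgM; pose X0 : fgm := existT _ M fgM.
pose X n := iter n fgm_ker X0.
pose P n := freem (cov_n (fgm_cover (X n))).
pose d n : {linear P n.+1 -> P n} :=
  cov_i (fgm_cover (X n)) \o cov_p (fgm_cover (X n.+1)).
have ex n : exact_at (d n) (cov_p (fgm_cover (X n))).
  move=> y; rewrite (@cov_exact _ (fgm_cover (X n))); split.
    by move=> [x <-]; have [z <-] := cov_surj (fgm_cover (X n.+1)) x; exists z.
  by move=> [z <-]; exists (cov_p (fgm_cover (X n.+1)) z).
have exn n : exact_at (d n.+1) (d n).
  move=> y; rewrite -ex /=; split=> [h|->]; last by rewrite linear0.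
  by apply: (@cov_inj _ (fgm_cover (X n))); rewrite h linear0.
by exists (@Build_projective_resolution R M P (cov_p (fgm_cover X0)) d
  (fun n => @projective_free _) (cov_surj _) (ex 0%N) exn).
Qed.

End FreeResolution.
End FreeModules.

(** * Flat modules *)

Section QuotientGroup.
Variables (Z : zmodType) (W : set Z) (W0 : W 0)
  (WB : forall x y, W x -> W y -> W (x - y)).

Definition subgroup_pred of W 0 & (forall x y, W x -> W y -> W (x - y)) :
  {pred Z} := fun x => `[< W x >].

Lemma subgroup_closed : zmod_closed (subgroup_pred W0 WB).
Proof.
split=> [|x y /asboolP Wx /asboolP Wy]; first exact/asboolP.
exact/asboolP/WB.
Qed.

HB.instance Definition _ := GRing.isZmodClosed.Build Z (subgroup_pred W0 WB)
  subgroup_closed.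

Lemma quotient_group : exists (Q : zmodType) (p : {additive Z -> Q}),
  forall x, p x = 0 <-> W x.
Proof.
exists (Quotient.quot (subgroup_pred W0 WB)).
exists (\pi_(Quotient.quot (subgroup_pred W0 WB))) => x.
have <- : \pi_(Quotient.quot (subgroup_pred W0 WB)) 0 = 0 by rewrite raddf0.
split=> [/eqmodP|Wx]; last apply/eqmodP; rewrite /= /Quotient.equiv subr0.
  by move=> /asboolP.
exact/asboolP.
Qed.

End QuotientGroup.

Section TensorSums.
Variables (R : nzRingType) (A : lmodType R^c) (M : lmodType R).

Lemma tens0l (m : M) : tens (0 : A) m = 0.
Proof.
have [hD _ _] := tens_balanced A M; apply: (addrI (tens (0 : A) m)).
by rewrite -hD !addr0.
Qed.

Lemma tens0r (a : A) : tens a (0 : M) = 0.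
Proof.
have [_ hD _] := tens_balanced A M; apply: (addrI (tens a (0 : M))).
by rewrite -hD !addr0.
Qed.

Lemma tens_suml (I : Type) (r : seq I) (F : I -> A) (m : M) :
  tens (\sum_(i <- r) F i) m = \sum_(i <- r) tens (F i) m.
Proof.
have [hD _ _] := tens_balanced A M.
by apply: (big_morph (fun a => tens a m)) => [a b|]; rewrite ?hD ?tens0l.
Qed.

Lemma tens_sumr (I : Type) (r : seq I) (a : A) (F : I -> M) :
  tens a (\sum_(i <- r) F i) = \sum_(i <- r) tens a (F i).
Proof.
have [_ hD _] := tens_balanced A M.
by apply: (big_morph (tens a)) => [m m'|]; rewrite ?hD ?tens0r.
Qed.

End TensorSums.

Section Flat.
Variables (R : nzRingType) (E : lmodType R).
Hypotheses (finR : @finlen R R^o) (flatE : flat E).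

(* [a] is a matrix over [R] each of whose columns is killed by the rows [e l],
   so [flat_span e] is the image of [ker e (x) E] in [E^n]. *)
Definition flat_span n m (e : 'I_m -> 'I_n -> R) : set {ffun 'I_n -> E} :=
  [set z | exists q (a : 'I_n -> 'I_q -> R) (y : 'I_q -> E),
    (forall l j, \sum_(i < n) e l i * a i j = 0) /\
    forall i, z i = \sum_(j < q) a i j *: y j].

Lemma flat_span0 n m (e : 'I_m -> 'I_n -> R) : flat_span e 0.
Proof.
exists 0%N, (fun _ _ => 0), (fun=> 0); split=> [l []//|i].
by rewrite big_ord0 ffunE.
Qed.

Lemma flat_spanB n m (e : 'I_m -> 'I_n -> R) u v :
  flat_span e u -> flat_span e v -> flat_span e (u - v).
Proof.
move=> [q [a [y [ea uE]]]] [q' [a' [y' [ea' vE]]]].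
exists (q + q')%N, (fun i j => match split j with inl j => a i j | inr j => a' i j end).
exists (fun j => match split j with inl j => y j | inr j => - y' j end).
split=> [l j|i]; first by case: (split j).
rewrite !ffunE big_split_ord uE vE -sumrN /=; congr (_ + _); apply: eq_bigr => j _.
  by rewrite (unsplitK (inl j)).
by rewrite (unsplitK (inr j)) scalerN.
Qed.

Lemma flat_span1 n m (e : 'I_m -> 'I_n -> R) (c : 'I_n -> R) (y : E) :
  (forall l, \sum_(i < n) e l i * c i = 0) -> flat_span e [ffun i => c i *: y].
Proof.
move=> ec; exists 1%N, (fun i _ => c i), (fun=> y); split=> // i.
by rewrite big_ord1 ffunE.
Qed.

(** Equational criterion for flatness. Let [N] be the image of the right-module map [G] with matrix
    [e]. The element [t] of [N (x) E] dies in [R^m (x) E] by the relations on [x], so it is zero by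
    flatness. Lifting an element of [N] to [R^n] is well defined modulo [ker G], which gives a
    balanced map from [N] and [E] to [E^n] modulo [flat_span e]; it sends [t] to the class of
    [x]. *)
Lemma flat_relations n m (e : 'I_m -> 'I_n -> R) (x : {ffun 'I_n -> E}) :
  (forall l, \sum_(i < n) e l i *: x i = 0) -> flat_span e x.
Proof.
move=> ex; pose Fn := freem R^c n; pose Fm := freem R^c m.
have hG : linear (fun a : Fn => [ffun l => \sum_(i < n) e l i * (a i : R)] : Fm).
  move=> r a b; apply/ffunP => l; rewrite !ffunE.
  rewrite -[RHS]/((\sum_(i < n) e l i * (a i : R)) * (r : R) + \sum_(i < n) e l i * (b i : R)).
  rewrite mulr_suml -big_split; apply: eq_bigr => i _ /=.
  rewrite !ffunE -[_ *: _]/((a i : R) * (r : R)).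
  by rewrite -[LHS]/(e l i * ((a i : R) * (r : R) + (b i : R))) mulrDr mulrA.
pose G : {linear Fn -> Fm} := mk_linear hG.
have GE a l : G a l = \sum_(i < n) e l i * (a i : R) by rewrite mk_linearE ffunE.
have [N [i [inj_i iP]]] := subm_exists (submod_range G).
have [G' G'E] : exists G' : {linear Fn -> N}, forall a, i (G' a) = G a.
  by apply: factor_inj => // a; apply/iP; exists a.
have /choice [s sE] : forall v, exists a, G' a = v.
  move=> v; have [a _ Ga] : range G (i v) by apply/iP; exists v.
  by exists a; apply: inj_i; rewrite G'E.
have [Q [p pP]] := quotient_group (flat_span0 e) (@flat_spanB n m e).
pose vec (a : Fn) (y : E) : {ffun 'I_n -> E} := [ffun k => (a k : R) *: y].
have vecW (a b : Fn) y : G' a = G' b -> p (vec a y) = p (vec b y).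
  move=> ab; apply/subr0_eq; rewrite -raddfB; apply/pP.
  rewrite (_ : _ - _ = [ffun k => ((a - b) k : R) *: y]); last first.
    by apply/ffunP => k; rewrite !ffunE scalerBl.
  apply: flat_span1 => l; rewrite -GE.
  have -> : G (a - b) = 0 by rewrite linearB -!G'E ab subrr.
  by rewrite ffunE.
pose b (v : N) (y : E) : Q := p (vec (s v) y).
have bal : balanced b.
  split=> [v w y|v y z|v r y]; rewrite /b.
  - rewrite -raddfD (vecW _ (s v + s w)); last by rewrite linearD !sE.
    by congr (p _); apply/ffunP => k; rewrite !ffunE scalerDl.
  - by rewrite -raddfD; congr (p _); apply/ffunP => k; rewrite !ffunE scalerDr.
  - rewrite (vecW _ ((r : R^c) *: s v)); last by rewrite linearZ /= !sE.
    by congr (p _); apply/ffunP => k; rewrite !ffunE scalerA.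
pose t : tensor N E := \sum_(k < n) tens (G' (basis_vec _ k)) (x k).
have t0 : t = 0.
  have mapB : zmod_morphism (@tensor_map R N Fm E i).
    exact/tensor_lift_is_zmod_morphism/tensor_map_balanced.
  pose map : {additive tensor N E -> tensor Fm E} :=
    HB.pack (@tensor_map R N Fm E i) (GRing.isZmodMorphism.Build _ _ _ mapB).
  apply: (flatE inj_i); change (map t = map 0); rewrite [RHS]raddf0 /t [LHS]raddf_sum.
  transitivity (\sum_(k < n) \sum_(l < m)
      tens (basis_vec R^c l : Fm) (e l k *: x k)).
    apply: eq_bigr => k _; rewrite -[map _]/(tensor_map i _) tensor_mapE G'E [G _]freemE tens_suml.
    apply: eq_bigr => l _; have [_ _ ->] := tens_balanced Fm E; congr (tens _ (_ *: _)).
    rewrite GE (bigD1 k) //= big1 => [|j /negbTE jk]; rewrite ffunE ?jk ?mulr0 //.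
    by rewrite eqxx mulr1 addr0.
  rewrite exchange_big big1 // => l _.
  by rewrite -tens_sumr ex tens0r.
apply/pP; have liftB := tensor_lift_is_zmod_morphism bal.
pose lift : {additive tensor N E -> Q} :=
  HB.pack (tensor_lift b) (GRing.isZmodMorphism.Build _ _ _ liftB).
have : lift t = 0 by rewrite t0 raddf0.
rewrite /t raddf_sum => <-.
transitivity (p (\sum_(k < n) vec (basis_vec R^c k) (x k))).
  congr (p _); apply/ffunP => j; rewrite sum_ffunE (bigD1 j) //= big1 => [|k /negbTE jk].
    by rewrite !ffunE eqxx scale1r addr0.
  by rewrite !ffunE eq_sym jk scale0r.
rewrite raddf_sum; apply: eq_bigr => k _.
rewrite -[lift _]/(tensor_lift b _) tensor_liftE //.
by apply: vecW; rewrite sE.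
Qed.

(** By finite length, [N] has finitely many generators and finitely many relations [e l]. The matrix
    [a] supplied by [flat_relations] kills these relations, so it induces [g] on [N], while [y]
    gives [h]. *)
Lemma flat_factor (N : lmodType R) (f : {linear N -> E}) : fin_generated N ->
  exists p (g : {linear N -> freem R p}) (h : {linear freem R p -> E}),
    forall x, h (g x) = f x.
Proof.
move=> /fin_generated_cover [n [c surj_c]].
pose fc : {linear freem R n -> E} := f \o c.
have [m [e eE]] := finlen_submod_lspan (finlen_free finR n) (submod_ker fc).
pose x : {ffun 'I_n -> E} := [ffun i => fc (basis_vec R i)].
have [|q [a [y [ea xE]]]] := @flat_relations n m (fun l i => e l i) x.
  move=> l; have : [set z | fc z = 0] (e l) by rewrite eE; apply: lspan_mem.
  move=> fe0; have {}fe0 : fc (e l) = 0 := fe0.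
  rewrite -[RHS]fe0 [in RHS]linear_free.
  by apply: eq_bigr => i _; rewrite ffunE.
pose h := free_map y.
pose g' : {linear freem R n -> freem R q} := free_map (fun i => [ffun j => a i j] : freem R q).
have g'E z j : g' z j = \sum_(i < n) (z i : R) * a i j.
  by rewrite free_mapE sum_ffunE; apply: eq_bigr => i _; rewrite !ffunE.
have hg' z : h (g' z) = fc z.
  have -> : fc z = _ := linear_free fc z.
  rewrite [g' z]free_mapE linear_sum; apply: eq_bigr => i _.
  rewrite linearZ; congr (_ *: _); have := xE i; rewrite ffunE => xi.
  rewrite -[RHS]/(fc (basis_vec R i)) xi.
  by rewrite free_mapE; apply: eq_bigr => j _; rewrite ffunE.
have [|g gE] := @factor_surj R _ _ _ c g' surj_c.
  move=> z cz0; have : [set z | fc z = 0] z by rewrite /= /fc /= cz0 linear0.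
  rewrite eE => -[d ->]; rewrite linear_sum big1 // => l _.
  rewrite linearZ; have -> : g' (e l) = 0 by apply/ffunP => j; rewrite g'E ea ffunE.
  exact: scaler0.
exists q, g, h => u; have [z <-] := surj_c u.
by rewrite gE hg'.
Qed.

End Flat.

(** * Flat injective hulls are finitely generated *)

Section FlatHull.
Variable R : nzRingType.
Hypothesis finR : @finlen R R^o.

(* Greedy choice: as long as the intersection is nonzero, some [F i] strictly
   decreases it. *)
Lemma finite_separation (M : lmodType R) rk (I : Type) (i0 : I) (F : I -> set M) :
  @rank_between R M [set 0] setT rk -> (forall i, submodule (F i)) ->
  (forall x, (forall i, F i x) -> x = 0) ->
  exists c : 'I_(rk setT).+1 -> I, forall x, (forall t, F (c t) x) -> x = 0.
Proof.
move=> hrk hF F0.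
pose J n (c : nat -> I) : set M := [set x | forall t, (t < n)%N -> F (c t) x].
have hJ n c : submodule (J n c) by apply: submod_bigI.
suff key n : exists c, J n c `<=` [set 0] \/ (rk (J n c) + n <= rk setT)%N.
  have [c [J0|]] := key (rk setT).+1; last by rewrite addnS ltnNge leq_addl.
  exists (fun t => c t) => x hx; apply: J0 => t tn.
  exact: (hx (Ordinal tn)).
elim: n => [|n [c IH]].
  exists (fun=> i0); right; rewrite addn0.
  by apply: (rank_leq hrk) => //= _ ->; apply: submod0.
have JS c' : (forall t, (t < n)%N -> c' t = c t) -> J n.+1 c' `<=` J n c.
  by move=> cc' x Jx t tn; rewrite -cc' //; apply: Jx; apply: ltnW.
have [J0|] := pselect (J n c `<=` [set 0]).
  by exists c; left; apply: subset_trans J0; apply: JS.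
move=> /[dup] J0 /existsNP[x /not_implyP[Jx x0]]; case: IH => // IH.
have [i Fix] : exists i, ~ F i x.
  by apply: contrapT => h; apply/x0/F0 => i; apply: contrapT => Fx; apply: h; exists i.
pose c' t := if t == n then i else c t.
have cc' t : (t < n)%N -> c' t = c t by rewrite /c' => tn; rewrite ltn_eqF.
exists c'; right; rewrite addnS -addSn; apply: leq_trans IH; rewrite leq_add2r.
apply: hrk => //; [by move=> _ ->; apply: submod0|exact: JS|].
by move=> /(_ x Jx n (ltnSn n)); rewrite /c' eqxx.
Qed.

Lemma fin_generated_preim (N M : lmodType R) (i : {linear N -> M}) n (e : 'I_n -> M) :
  injective i -> range i = lspan e -> fin_generated N.
Proof.
move=> inj_i iE.
have /choice [e' e'E] : forall j, exists x, i x = e j.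
  move=> j; have [x _ <-] : range i (e j) by rewrite iE; apply: lspan_mem.
  by exists x.
exists n, e' => x; have [c cE] : lspan e (i x) by rewrite -iE; exists x.
exists c; apply: inj_i; rewrite cE linear_sum; apply: eq_bigr => j _.
by rewrite linearZ /= e'E.
Qed.

Variables (E : lmodType R) (u : {linear R^o -> E}).
Hypotheses (flatE : flat E) (inj_u : injective u) (ess_u : essential_image u).

Lemma regular_linear (f : {linear R^o -> E}) (r : R) : f r = r *: f 1.
Proof. by rewrite -linearZ -[_ *: 1]/(r * 1) mulr1. Qed.

(** The order of quantifiers matters: [s] must not depend on [N]. The coordinates of [g0] separate
    the multiples of [u 1], and the rank of [R] bounds how many of them are needed for that. A
    kernel left over on [N] would meet the image of [u] by essentiality. *)
Lemma flat_hull_embeds : exists s, forall (N : lmodType R) (i : {linear N -> E}),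
  fin_generated N -> injective i -> range i (u 1) ->
  exists g : {linear N -> freem R s}, injective g.
Proof.
have [rk hrk] := finR; exists (rk setT).+1 => N i fgN inj_i [n0 _ n0E].
have [p [g0 [h hg0]]] := flat_factor finR flatE i fgN.
pose F (j : 'I_p) : set R^o := [set r : R | g0 (r *: n0) j = 0].
have hF j : submodule (F j).
  split=> [|r x y]; rewrite /F /=; first by rewrite scale0r linear0 ffunE.
  rewrite scalerDl -scalerA linearP !ffunE => -> ->.
  by rewrite scaler0 addr0.
have F0 (r : R^o) : (forall j, F j r) -> r = 0.
  move=> Fr; apply: inj_u; rewrite linear0 regular_linear -n0E -linearZ -hg0.
  by rewrite (_ : g0 _ = 0) ?linear0 //; apply/ffunP => j; rewrite ffunE; apply: Fr.
(* The greedy choice needs a default coordinate; one exists because [1] is nonzero. *)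
have [j0 _] : exists j0, ~ F j0 1.
  apply: contrapT => nF; have /eqP := oner_neq0 R; apply.
  by apply: F0 => j; apply: contrapT => Fj; apply: nF; exists j.
have [c cP] := finite_separation j0 hrk hF F0.
have hg : linear (fun x => [ffun t => g0 x (c t)] : freem R (rk setT).+1).
  by move=> r x y; apply/ffunP => t; rewrite !ffunE linearP !ffunE.
exists (mk_linear hg); apply: ker0_inj => x gx0; apply: contrapT => x0.
have hK := submod_im i (submod_ker (mk_linear hg)).
have [|r [ur0 [y gy0 yE]]] := ess_u hK.
  move=> K0; have : [set (0 : E)] (i x) by rewrite -K0; exists x.
  by move=> ix0; apply: x0; apply: inj_i; rewrite ix0 linear0.
apply: ur0; rewrite (cP r) ?linear0 // => t.
rewrite /F /=; have <- : y = r *: n0.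
  apply: inj_i; rewrite yE linearZ n0E; exact: regular_linear.
have gy0' : mk_linear hg y = 0 := gy0.
by have := congr1 (fun v : freem R _ => v t) gy0'; rewrite mk_linearE !ffunE.
Qed.

(** Otherwise adjoining elements outside the span gives ever longer submodules containing [u 1], all
    embedded in the same free module of finite length. *)
Lemma flat_hull_fin_generated : fin_generated E.
Proof.
apply: contrapT => nfg; have [s emb] := flat_hull_embeds.
have [rk hrk] := finlen_free finR s.
(* The bound is required for every embedding [g], because the embedding of the enlarged span is
   unrelated to earlier ones; the induction restricts it to the smaller span. *)
suff key n : exists m (e : 'I_m -> E), lspan e (u 1) /\
    forall (N : lmodType R) (i : {linear N -> E}) (g : {linear N -> freem R s}),
    injective i -> injective g -> range i = lspan e -> (n <= rk (range g))%N.
  have [m [e [eu eP]]] := key (rk setT).+1.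
  have [N [i [inj_i iP]]] := subm_exists (submod_lspan e).
  have iE : range i = lspan e.
    by apply/seteqP; split=> x; [case=> y _ <-; apply/iP; exists y|move=> /iP [y <-]; exists y].
  have [|g inj_g] := emb N i (fin_generated_preim inj_i iE) inj_i; first by rewrite iE.
  have := eP N i g inj_i inj_g iE; rewrite ltnNge => /negP; apply.
  apply: (rank_leq hrk) => //=; first exact: submod_range.
  by move=> _ ->; apply: submod0; apply: submod_range.
elim: n => [|n [m [e [eu eP]]]].
  by exists 1%N, (fun=> u 1); split=> //; apply: (lspan_mem (fun=> u 1) ord0).
have [z ez] : exists z, ~ lspan e z.
  apply: contrapT => h; apply: nfg; exists m, e => x.
  by apply: contrapT => ex; apply: h; exists x.
have [e' e'E] := lspan_rcons e z.
have ee' : lspan e `<=` lspan e' by rewrite e'E; apply: addset_subl; apply: submod_cyc.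
exists m.+1, e'; split=> [|N' i' g' inj_i' inj_g' i'E]; first exact: ee'.
have [N [i [inj_i iP]]] := subm_exists (submod_lspan e).
have iE : range i = lspan e.
  by apply/seteqP; split=> x; [case=> y _ <-; apply/iP; exists y|move=> /iP [y <-]; exists y].
have [j jE] : exists j : {linear N -> N'}, forall x, i' (j x) = i x.
  apply: factor_inj => // x; have [y _ yE] : range i' (i x).
    by rewrite i'E; apply: ee'; rewrite -iE; exists x.
  by exists y.
have inj_gj : injective (g' \o j : {linear N -> freem R s}).
  by move=> x y /= /inj_g' /(congr1 i'); rewrite !jE => /inj_i.
apply: leq_ltn_trans (eP N i (g' \o j : {linear N -> freem R s}) inj_i inj_gj iE) _.
apply: hrk => //; [exact: submod_range|exact: submod_range| | |].
- by move=> _ ->; apply: submod0; apply: submod_range.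
- by move=> _ [x _ <-]; exists (j x).
have [x _ xz] : range i' z.
  rewrite i'E e'E; apply: addset_subr (cyc_id z); exact: submod_lspan.
move=> /(_ (g' x)) [|y _ /= /inj_g' jyx]; first by exists x.
by apply: ez; rewrite -xz -jyx jE -iE; exists y.
Qed.

End FlatHull.

Lemma fin_generated_flat_projective (R : nzRingType) (E : lmodType R) :
  @finlen R R^o -> flat E -> fin_generated E -> projective_module E.
Proof.
move=> finR flatE fgE.
have [p [g [h hg]]] := flat_factor finR flatE (idfun : {linear E -> E}) fgE.
by apply: (projective_retract hg); apply: projective_free.
Qed.

(** * Finitistic dimension and grade *)

Section SelfInjectiveFinDim.
Variable R : nzRingType.
Hypotheses (finR : @finlen R R^o) (injR : self_injective R).

(* Dimension shifting: [Ext^j(M, K)] embeds into [Ext^(j+1)(M, K1)] for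
   [0 -> K1 -> F -> K -> 0] with [F] free of finite rank, hence injective. *)
Lemma self_injective_cocycle (M : lmodType R) (P : projective_resolution M) n :
  (forall i, (n < i)%N -> forall x : P i, x = 0) ->
  forall m j (K : lmodType R) (f : {linear P j.+1 -> K}), (n <= j + m)%N ->
    fin_generated K -> (forall x, f (pres_diff P j.+1 x) = 0) ->
    exists g : {linear P j -> K}, forall x, f x = g (pres_diff P j x).
Proof.
move=> P0; elim=> [|m IHm] j K f.
  rewrite addn0 -ltnS => nj _ _; exists (zero_map _ _) => x.
  by rewrite (P0 _ nj x) !linear0.
rewrite addnS => njm fgK fd; have [c _] := cover_exists finR fgK.
have [f1 f1E] := @pres_projective _ _ P j.+1 _ _ (cov_p c) f (@cov_surj _ _ c).
have [phi phiE] : exists phi : {linear P j.+2 -> cov_ker c},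
    forall x, cov_i c (phi x) = f1 (pres_diff P j.+1 x).
  apply: (@factor_inj R _ _ _ (cov_i c) (f1 \o pres_diff P j.+1 : {linear P j.+2 -> _})).
    exact: cov_inj.
  by move=> x; apply/(@cov_exact _ _ c); rewrite f1E fd.
have dd i x : pres_diff P i (pres_diff P i.+1 x) = 0.
  by apply/pres_exact; exists x.
have [//||x|g gE] := IHm j.+1 _ phi; first exact: cov_fg.
  by apply: (@cov_inj _ _ c); rewrite phiE dd !linear0.
(* Subtracting [cov_i c \o g] makes the lift [f1] vanish on boundaries, so it extends along
   [pres_diff P j] into the injective free module; the correction disappears after [cov_p c]. *)
have [x|h hE] := @injective_ext R _ _ _ (pres_diff P j)
    (f1 \- (cov_i c \o g) : {linear P j.+1 -> _}) (injective_free injR (n := _)).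
  by move=> /pres_exact[y <-] /=; rewrite -gE phiE subrr.
exists (cov_p c \o h : {linear P j -> K}) => x /=.
rewrite hE /= linearB f1E /= (_ : cov_p c (cov_i c (g x)) = 0) ?subr0 //.
by apply/(@cov_exact _ _ c); exists (g x).
Qed.

(** The class of a free cover of [M] in [Ext^1(M, K)], with [K] its kernel, is represented by [phi]
    and vanishes by the previous lemma. Hence the cover splits and [M] is a summand of a free
    module. *)
Lemma self_injective_fin_dim : fin_dim_eq R 0.
Proof.
split=> // M fgM [n [P P0]]; apply/proj_dim_le0P.
have [c _] := cover_exists finR fgM.
have [u uE] := @pres_projective _ _ P 0%N _ _ (cov_p c) (pres_aug P) (@cov_surj _ _ c).
have [phi phiE] : exists phi : {linear P 1%N -> cov_ker c},
    forall x, cov_i c (phi x) = u (pres_diff P 0%N x).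
  apply: (@factor_inj R _ _ _ (cov_i c) (u \o pres_diff P 0%N : {linear P 1%N -> _})).
    exact: cov_inj.
  by move=> x; apply/(@cov_exact _ _ c); rewrite uE; apply/pres_exact0; exists x.
have [|x|g gE] := @self_injective_cocycle M P n P0 n 0%N _ phi (leq_addl _ _).
- exact: cov_fg.
- apply: (@cov_inj _ _ c); rewrite phiE linear0.
  by rewrite (_ : pres_diff P 0 _ = 0) ?linear0 //; apply/pres_exact; exists x.
have [x|s sE] := @factor_surj R _ _ _ (pres_aug P)
    (u \- (cov_i c \o g) : {linear P 0%N -> _}) (@pres_aug_surj _ _ P).
  by move=> /pres_exact0[y <-] /=; rewrite -gE phiE subrr.
apply: (@projective_retract R M _ s (cov_p c)); last exact: projective_free.
move=> x; have [y <-] := @pres_aug_surj _ _ P x.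
rewrite sE /= linearB uE /= (_ : cov_p c (cov_i c (g y)) = 0) ?subr0 //.
by apply/(@cov_exact _ _ c); exists (g y).
Qed.

End SelfInjectiveFinDim.

Lemma injective_retract (R : nzRingType) (A E : lmodType R)
    (s : {linear A -> E}) (r : {linear E -> A}) :
  (forall x, r (s x) = x) -> injective_module E -> injective_module A.
Proof.
move=> rs injE X Y f g inj_f.
have [h hE] := injE _ _ f (s \o g : {linear X -> E}) inj_f.
by exists (r \o h : {linear Y -> A}) => x /=; rewrite hE /= rs.
Qed.

Lemma fin_dim0_self_injective (R : nzRingType) (E : min_injective_resolution R^o) :
  @finlen R R^o -> flat (E 0%N) -> fin_dim_le R 0 -> self_injective R.
Proof.
move=> finR flatE fd0.
have inj_u := @ires_aug_inj _ _ E.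
have fgE := flat_hull_fin_generated finR flatE inj_u (@ires_min0 _ _ E).
have projE := fin_generated_flat_projective finR flatE fgE.
(* By exactness the cokernel of the augmentation is the image of the first differential. *)
have [C [i [inj_i iP]]] := subm_exists (submod_range (ires_diff E 0)).
have [p pE] : exists p : {linear E 0%N -> C}, forall x, i (p x) = ires_diff E 0 x.
  by apply: factor_inj => // x; apply/iP; exists x.
have surj_p : surjective p.
  move=> y; have [x _ xE] : range (ires_diff E 0) (i y) by apply/iP; exists y.
  by exists x; apply: inj_i; rewrite pE.
have ex : exact_at (ires_aug E) p.
  move=> y; rewrite -(@ires_exact0 _ _ E y) -pE; split=> [->|py]; first by rewrite linear0.
  by apply: inj_i; rewrite py linear0.
have pdC : finite_proj_dim C.
  by exists 1%N; apply: (proj_dim_le1 _ _ inj_u surj_p ex) => //; apply: projective_regular.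
have /proj_dim_le0P projC := fd0 C (fin_generated_image surj_p fgE) pdC.
have [s sE] := projC _ _ p idfun surj_p.
have [r rE] : exists r : {linear E 0%N -> R^o},
    forall y, ires_aug E (r y) = y - s (p y).
  apply: (@factor_inj R _ _ _ (ires_aug E) (idfun \- (s \o p) : {linear E 0%N -> E 0%N}) inj_u).
  by move=> y; apply/(ex _); rewrite /= linearB sE /= subrr.
apply: (@injective_retract R _ (E 0%N) (ires_aug E) r); last exact: ires_injective.
move=> x; have px : p (ires_aug E x) = 0 by apply/(ex _); exists x.
by apply: inj_u; rewrite rE px (linear0 s) subr0.
Qed.

Section MaximalSubmodules.
Variable R : nzRingType.

Definition maximal_submod (M : lmodType R) (N : set M) : Prop :=
  [/\ submodule N, ~ [set: M] `<=` N &
    forall T, submodule T -> N `<=` T -> ~ [set: M] `<=` T -> T `<=` N].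

Lemma maximal_submod_exists (M : lmodType R) (S : set M) :
  finlen M -> submodule S -> ~ [set: M] `<=` S ->
  exists N, maximal_submod N /\ S `<=` N.
Proof.
move=> finM hS nS.
have [|N [hN [SN nN] Nmax]] := @finlen_max R M
  (fun T => S `<=` T /\ ~ [set: M] `<=` T) S finM hS; first by split.
exists N; split=> //; split=> // T hT NT nT; apply: Nmax => //.
by split=> //; apply: subset_trans NT.
Qed.

Lemma maximal_submod_add (M : lmodType R) (N : set M) x y :
  maximal_submod N -> ~ N x -> exists r, N (y - r *: x).
Proof.
move=> [hN nN Nmax] Nx.
have hadd : submodule (addset N (cyc x)) by apply: submod_add => //; apply: submod_cyc.
have [Ny|h] := pselect (addset N (cyc x) y).
  by have [n [_ [Nn [r ->] ->]]] := Ny; exists r; rewrite ?addrK.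
case: Nx; apply: (Nmax _ hadd).
- by apply: addset_subl; apply: submod_cyc.
- by move=> h'; apply: h; apply: h'.
- by apply: addset_subr (cyc_id x).
Qed.

Lemma maximal_submod_ideal (M : lmodType R) (N : set M) x :
  maximal_submod N -> ~ N x -> maximal_left_ideal [set r : R | N (r *: x)].
Proof.
move=> mN Nx; have [hN _ _] := mN.
have hI : left_ideal [set r : R | N (r *: x)].
  split=> [|r a b] /=; first by rewrite scale0r; apply: submod0.
  by rewrite scalerDl -scalerA => Na Nb; apply: hN.2.
split.
  split=> // IT; apply: Nx; have : [set r : R | N (r *: x)] 1 by rewrite IT.
  by rewrite /= scale1r.
move=> J [hJ nJ] IJ; apply/seteqP; split=> // r Jr; apply: contrapT => Nrx.
apply: nJ; have [s Ns] := maximal_submod_add x mN Nrx.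
have J1 : J 1.
  rewrite -[1](subrK (s * r)); apply: (submodD (M := R^o) hJ).
    by apply: IJ; rewrite /= scalerBl scale1r -scalerA.
  exact: (submodZ (M := R^o) s hJ).
apply/seteqP; split=> // z _; rewrite -[z]mulr1.
exact: (submodZ (M := R^o) z hJ J1).
Qed.

(** Already [Hom(M, R)] is nonzero: a simple quotient of [M] is [R/I] with [I] the annihilator of
    the class of [y], and an element [a] killed by [I] on the left defines the map [r y |-> r a]. *)
Lemma annihilators_grade_finite : @finlen R R^o ->
  (forall I : set R, maximal_left_ideal I ->
     exists x, right_annihilator I x /\ x <> 0) ->
  forall M : lmodType R, fin_generated M -> nonzero_module M -> grade_finite M.
Proof.
move=> finR ann M fgM [x0 x0N0].
have [|N [mN _]] := maximal_submod_exists (finlen_fin_generated finR fgM) (submod_set0 M).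
  by move=> h; apply/x0N0/h.
have [hN nN _] := mN.
have [y Ny] : exists y, ~ N y.
  by apply: contrapT => h; apply: nN => y _; apply: contrapT => Ny; apply: h; exists y.
have [a [Ia a0]] := ann _ (maximal_submod_ideal mN Ny).
have [Q [pi [surj_pi piE]]] := quom_exists hN.
have ql : linear (fun r : R^o => (r : R) *: pi y).
  by move=> r s t; rewrite scalerDl scalerA.
have al : linear (fun r : R^o => (r : R) * a : R^o).
  by move=> r s t; rewrite mulrDl -[r *: s]/(r * s) -mulrA.
have [q|r|h hE] := @factor_surj R R^o Q R^o (mk_linear ql) (mk_linear al).
- have [z <-] := surj_pi q; have [r Nr] := maximal_submod_add z mN Ny.
  exists r; rewrite mk_linearE -linearZ; apply/esym/subr0_eq.
  by rewrite -linearB; apply/piE.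
- by rewrite !mk_linearE -linearZ => /piE /Ia.
exists 0%N => ext0; have [P _] := free_resolution finR fgM.
pose f : {linear P 0%N -> R^o} := h \o pi \o pres_aug P.
have fd : cocycle f.
  move=> x; rewrite /f /= (_ : pres_aug P _ = 0) ?linear0 //.
  by apply/pres_exact0; exists x.
have f0 x : h (pi (pres_aug P x)) = 0 by exact: (ext0 P f fd x).
have [x xE] := @pres_aug_surj _ _ P y; apply: a0.
by have := hE 1; rewrite !mk_linearE scale1r mul1r -xE f0 => <-.
Qed.

End MaximalSubmodules.

(** * Vanishing of Ext from maps into an injective resolution *)

Section ExtFromInjectiveResolution.
Variables (R : nzRingType) (M N : lmodType R) (E : min_injective_resolution N).
Hypothesis Hom0 : forall i (f : {linear M -> E i}) x, f x = 0.
Variable P : projective_resolution M.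

Lemma cocycle0_eq0 i (f : {linear P 0%N -> E i}) : cocycle f -> forall x, f x = 0.
Proof.
move=> fd; have [x|h hE] := @factor_surj R _ _ _ (pres_aug P) f (@pres_aug_surj _ _ P).
  by move=> /pres_exact0 [y <-]; apply: fd.
by move=> x; rewrite -hE Hom0.
Qed.

Lemma ires_dd i x : ires_diff E i.+1 (ires_diff E i x) = 0.
Proof. by apply/ires_exact; exists x. Qed.

(** Staircase argument in the double complex [Hom(P_j, E_i)]. An extension [h] of [f] need not be
    closed, but [ires_diff E i \o h] is a closed cocycle of one lower degree in [P] and one higher
    in [E]. Lifting its primitive to [E i] gives the correction of [h]. The staircase ends at [P 0],
    where [Hom0] applies. *)
Lemma closed_cocycle_coboundary j i (f : {linear P j.+1 -> E i}) : cocycle f ->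
  (forall x, ires_diff E i (f x) = 0) ->
  exists g : {linear P j -> E i},
    (forall x, f x = g (pres_diff P j x)) /\ forall x, ires_diff E i (g x) = 0.
Proof.
elim: j i f => [|j IHj] i f fd df.
all: have [x|h hE] := @injective_ext R _ _ _ (pres_diff P _) f (@ires_injective _ _ E i).
all: try by move=> /pres_exact[y <-]; apply: fd.
  exists h; split=> [x|]; first by rewrite hE.
  apply: (@cocycle0_eq0 _ (ires_diff E i \o h : {linear P 0%N -> E i.+1})) => x.
  by rewrite /= hE df.
have [x|x|g [gE dg]] := IHj i.+1 (ires_diff E i \o h : {linear P j.+1 -> E i.+1}).
- by rewrite /= hE df.
- exact: ires_dd.
have [x|g' g'E] := @projective_lift R _ _ _ (ires_diff E i) g (@pres_projective _ _ P j).
  by apply/ires_exact.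
exists (h \- (g' \o pres_diff P j) : {linear P j.+1 -> E i}); split=> x /=.
  have -> : pres_diff P j (pres_diff P j.+1 x) = 0 by apply/pres_exact; exists x.
  by rewrite hE (linear0 g') subr0.
by rewrite linearB g'E -gE subrr.
Qed.

Lemma cocycle_coboundary j (f : {linear P j -> N}) : cocycle f -> coboundary f.
Proof.
case: j f => [|j] f fd.
  move=> x; apply: (@ires_aug_inj _ _ E); rewrite linear0.
  apply: (@cocycle0_eq0 _ (ires_aug E \o f : {linear P 0%N -> E 0%N})) => y.
  by rewrite /= fd linear0.
have [x|x|g [gE dg]] := @closed_cocycle_coboundary j 0%N
  (ires_aug E \o f : {linear P j.+1 -> E 0%N}).
- by rewrite /= fd linear0.
- by apply/ires_exact0; exists (f x).
have [x|g' g'E] := @factor_inj R _ _ _ (ires_aug E) g (@ires_aug_inj _ _ E).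
  by apply/ires_exact0.
by exists g' => x; apply: (@ires_aug_inj _ _ E); rewrite g'E -gE.
Qed.

End ExtFromInjectiveResolution.

Lemma grade_finite_Hom (R : nzRingType) (M : lmodType R)
    (E : min_injective_resolution R^o) :
  grade_finite M -> exists i (f : {linear M -> E i}) x, f x <> 0.
Proof.
move=> [j ext]; apply: contrapT => h; apply: ext => P f.
apply: (@cocycle_coboundary _ _ _ E) => i g x.
by apply: contrapT => gx; apply: h; exists i, g, x.
Qed.

(** * Simple modules *)

Section MaximalLeftIdeals.
Variable R : nzRingType.
Implicit Types (I J : set R) (M T : lmodType R).

Lemma proper_left_ideal1 I : proper_left_ideal I -> ~ I 1.
Proof.
move=> [hI nI] I1; apply: nI; apply/seteqP; split=> // z _; rewrite -[z]mulr1.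
exact: (submodZ (M := R^o) z hI I1).
Qed.

Lemma maximal_left_ideal_submod I : maximal_left_ideal I <-> @maximal_submod R R^o I.
Proof.
split=> [[pI Imax]|[hI nI Imax]].
  have [hI nI] := pI; split=> //.
    by move=> TI; apply: (proper_left_ideal1 pI); apply: TI.
  move=> T hT IT nT; rewrite (Imax T) //; split=> // TT.
  by apply: nT; rewrite TT.
split; first by split=> // IT; apply: nI; rewrite IT.
move=> J pJ IJ; have [hJ nJ] := pJ; apply/seteqP; split=> //; apply: Imax => //.
by move=> TJ; apply: (proper_left_ideal1 pJ); apply: TJ.
Qed.

Lemma maximal_left_ideal_inv I a : maximal_left_ideal I -> ~ I a ->
  exists c, I (1 - c * a).
Proof.
move=> /maximal_left_ideal_submod mI Ia.
by have [c Ic] := maximal_submod_add 1 mI Ia; exists c.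
Qed.

Lemma left_idealM I r a : left_ideal I -> I a -> I (r * a).
Proof. by move=> hI; apply: (submodZ (M := R^o)). Qed.

(* [R/I] has a nonzero homomorphism to [R/J]. *)
Definition cyclic_hom I J : Prop := exists2 a, ~ J a & forall r, I r -> J (r * a).

Lemma cyclic_hom_ann I J a : maximal_left_ideal I -> maximal_left_ideal J -> ~ J a ->
  (forall r, I r -> J (r * a)) -> forall r, J (r * a) -> I r.
Proof.
move=> mI mJ Ja IJ r Jra; have [pI _] := mI; have [[hJ _] _] := mJ; apply: contrapT => Ir.
have [c Ic] := maximal_left_ideal_inv mI Ir; apply: Ja.
rewrite -[a]mul1r -[1](subrK (c * r)) mulrDl; apply: (submodD (M := R^o) hJ).
  exact: IJ.
by rewrite -mulrA; apply: left_idealM.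
Qed.

(** Schur's lemma: [c] with [c * a = 1] modulo [J] defines the inverse map. *)
Lemma cyclic_hom_sym I J : maximal_left_ideal I -> maximal_left_ideal J ->
  cyclic_hom I J -> cyclic_hom J I.
Proof.
move=> mI mJ [a Ja IJ]; have [c Jc] := maximal_left_ideal_inv mJ Ja.
have [[hJ _] _] := mJ; have [pI _] := mI; have [hI _] := pI; exists c.
  move=> Ic; apply: (proper_left_ideal1 mJ.1).
  by rewrite -[1](subrK (c * a)); apply: (submodD (M := R^o) hJ) => //; apply: IJ.
move=> s Js; apply: (cyclic_hom_ann mI mJ Ja IJ).
have -> : s * c * a = s - s * (1 - c * a) by rewrite mulrBr mulr1 mulrA opprB addrC subrK.
by apply: (submodB (M := R^o) hJ) => //; apply: left_idealM.
Qed.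

(** A simple quotient of [R] modulo the intersection is a composition factor of the sum of the
    [R / F i]. If [J] contains the intersection but not that of the first [n] ideals, an [a]
    witnessing this has the same annihilator modulo [J] and modulo [F n], because both annihilators
    are maximal and one contains the other. *)
Lemma bigcap_maximal n (F : nat -> set R) J : (forall i, maximal_left_ideal (F i)) ->
  maximal_left_ideal J -> [set r | forall i, (i < n)%N -> F i r] `<=` J ->
  exists2 i, (i < n)%N & cyclic_hom J (F i).
Proof.
move=> mF mJ; elim: n => [|n IHn] FJ.
  by case: (proper_left_ideal1 mJ.1); apply: FJ.
have [h|] := pselect ([set r | forall i, (i < n)%N -> F i r] `<=` J).
  by have [i ilt hi] := IHn h; exists i => //; apply: ltnW.
move=> /existsNP[a /not_implyP[Fa Ja]]; exists n => //.
have capS r : (forall i, (i < n)%N -> F i r) -> F n r -> J r.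
  move=> Fr Fnr; apply: FJ => i; rewrite ltnS leq_eqVlt => /orP[/eqP ->//|].
  exact: Fr.
have Fna : ~ F n a by move=> Fna; apply/Ja/capS.
have [[hJ _] _] := mJ; have mFn := (maximal_left_ideal_submod (F n)).1 (mF n).
have [c Jc] := maximal_left_ideal_inv mJ Ja.
have [pI1 I1max] := maximal_submod_ideal mFn Fna.
have I2E : [set r : R | J (r * a)] = [set r : R | F n ((r : R) *: (a : R^o))].
  apply: I1max => [|r /= Fra].
    split=> [|TJ].
      split=> [|r x y] /=; first by rewrite mul0r; apply: (submod0 hJ).
      by rewrite mulrDl -[r *: x]/(r * x) -mulrA; apply: hJ.2.
    have : [set r : R | J (r * a)] 1 by rewrite TJ.
    by rewrite /= mul1r.
  by apply: capS => // i ilt; apply: left_idealM (Fa i ilt); have [[]] := mF i.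
have Jeq r : J (r * a) <-> F n (r * a).
  have E : [set r : R | J (r * a)] r <-> [set r : R | F n ((r : R) *: (a : R^o))] r by rewrite I2E.
  exact: E.
exists (c * a) => [/Jeq Jca|s Js].
  apply: (proper_left_ideal1 mJ.1).
  by rewrite -[1](subrK (c * a)); apply: (submodD (M := R^o) hJ).
rewrite mulrA; apply/Jeq.
have -> : s * c * a = s - s * (1 - c * a) by rewrite mulrBr mulr1 mulrA opprB addrC subrK.
by apply: (submodB (M := R^o) hJ) => //; apply: left_idealM.
Qed.

(* Up to [cyclic_hom] there are only finitely many maximal left ideals, so an
   injective total relation on them is onto: otherwise iterating it from a
   missed ideal yields infinitely many inequivalent ones. *)
Lemma pigeonhole (rel : set R -> set R -> Prop) : @finlen R R^o ->
  (forall I, maximal_left_ideal I -> exists2 J, maximal_left_ideal J & rel I J) ->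
  (forall I1 J1 I2 J2, maximal_left_ideal I1 -> maximal_left_ideal J1 ->
     maximal_left_ideal I2 -> maximal_left_ideal J2 -> rel I1 J1 -> rel I2 J2 ->
     cyclic_hom J1 J2 -> cyclic_hom I1 I2) ->
  forall J, maximal_left_ideal J -> exists I J',
    [/\ maximal_left_ideal I, maximal_left_ideal J', rel I J' & cyclic_hom J' J].
Proof.
move=> finR tot inj J mJ; apply: contrapT => noJ.
have /choice [f fP] : forall X : {I | maximal_left_ideal I},
    exists Y : {I | maximal_left_ideal I}, rel (sval X) (sval Y).
  by move=> [I mI]; have [K mK IK] := tot I mI; exists (exist _ K mK).
pose X n := iter n f (exist _ J mJ); pose F n := sval (X n).
have mF n : maximal_left_ideal (F n) by apply: svalP (X n).
have relF n : rel (F n) (F n.+1) by apply: fP.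
(* Injectivity carries an equivalence of [F (i + j).+1] with [F i] down to one of [F j.+1] with the
   missed ideal [J]. *)
have noniso i j : ~ cyclic_hom (F (i + j).+1) (F i).
  elim: i => [|i IHi] h; first by apply: noJ; exists (F j), (F j.+1).
  by apply: IHi; apply: (inj _ _ _ _ (mF _) (mF _) (mF _) (mF _) (relF _) (relF _)).
(* This descending chain is stationary, so some [F n] contains the intersection of its predecessors
   and is equivalent to one of them. *)
pose A n : set R^o := [set r | forall i, (i < n)%N -> F i r].
have hA n : submodule (A n).
  by apply: (@submod_bigI R R^o _ _ F) => i _; have [[]] := mF i.
have [S [_ [n ->] Smin]] := @finlen_min R R^o (fun S => exists n, S = A n) _ finR (hA 0%N)
  (ex_intro _ 0%N erefl).
have [i ilt hom] : exists2 i, (i < n)%N & cyclic_hom (F n) (F i).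
  apply: bigcap_maximal => // r Ar.
  have sub : A n.+1 `<=` A n by move=> s As i /ltnW; apply: As.
  exact: (Smin _ (hA n.+1) (ex_intro _ _ erefl) sub r Ar n (ltnSn n)).
apply: (noniso i (n - i.+1)%N); rewrite -addSn subnKC //.
Qed.

End MaximalLeftIdeals.

Section SimpleModules.
Variable R : nzRingType.
Implicit Types (I J : set R) (M T : lmodType R).

(** For maximal [I], such an [x] generates a copy of [R/I]; in [R^o] it is a nonzero element of the
    right annihilator of [I]. *)
Definition killed_by I M (x : M) : Prop := x <> 0 /\ forall r, I r -> r *: x = 0.

Lemma killed_by_ann I M (x : M) r : maximal_left_ideal I -> killed_by I x ->
  r *: x = 0 -> I r.
Proof.
move=> mI [x0 Ix] rx; apply: contrapT => Ir.
have [c Ic] := maximal_left_ideal_inv mI Ir; apply: x0.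
by rewrite -[x]scale1r -[1](subrK (c * r)) scalerDl Ix // -scalerA rx scaler0 addr0.
Qed.

Lemma killed_by_hom I J M (x : M) : maximal_left_ideal J ->
  cyclic_hom I J -> killed_by J x -> exists2 a : R, killed_by I (a *: x) & ~ J a.
Proof.
move=> mJ [a Ja IJ] kx; exists a => //; split=> [ax|r /IJ Jra].
  exact/Ja/(killed_by_ann mJ kx).
by rewrite scalerA kx.2.
Qed.

Lemma simple_surj M T (f : {linear M -> T}) y :
  simple_module T -> f y <> 0 -> surjective f.
Proof.
move=> [_ simT] fy z; have [h|h] := simT _ (submod_range f).
  by case: fy; have : [set (0 : T)] (f y) by rewrite -h; exists y.
have [x _ <-] : range f z by rewrite h.
by exists x.
Qed.

Lemma mul_linear M (x : M) : linear (fun r : R^o => (r : R) *: x).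
Proof. by move=> r s t; rewrite scalerDl scalerA. Qed.

Definition mul_map M (x : M) : {linear R^o -> M} := mk_linear (mul_linear x).

Lemma mul_mapE M (x : M) (r : R) : mul_map x r = r *: x.
Proof. by []. Qed.

Lemma mul_map_surj T (t : T) : simple_module T -> t <> 0 -> surjective (mul_map t).
Proof. by move=> simT t0; apply: (@simple_surj _ _ _ 1) => //; rewrite mul_mapE scale1r. Qed.

Lemma quotient_simple M (N : set M) : maximal_submod N ->
  exists T (p : {linear M -> T}),
    [/\ simple_module T, surjective p & forall x, p x = 0 <-> N x].
Proof.
move=> [hN nN Nmax]; have [T [p [surj_p pN]]] := quom_exists hN; exists T, p; split=> //.
split.
  apply: contrapT => h; apply: nN => x _; apply/pN; apply: contrapT => px.
  by apply: h; exists (p x).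
move=> S hS; have [TS|nTS] := pselect ([set: M] `<=` [set x | S (p x)]).
  right; apply/seteqP; split=> // y _; have [x <-] := surj_p y.
  exact: TS.
left; apply/seteqP; split=> [y Sy|_ ->]; last exact: submod0.
have [x xE] := surj_p y; rewrite -xE; apply/pN; apply: (Nmax _ (submod_preim p hS)) => //.
  by move=> z /pN pz /=; rewrite pz; apply: submod0.
by rewrite /= xE.
Qed.

Lemma simple_transport I J T1 T2 (t1 : T1) (t2 : T2) :
  maximal_left_ideal I -> maximal_left_ideal J ->
  simple_module T1 -> killed_by I t1 -> killed_by J t2 -> cyclic_hom I J ->
  exists f : {linear T1 -> T2}, f t1 <> 0.
Proof.
move=> mI mJ sim1 k1 k2 IJ; have [a [at0 Ia] _] := killed_by_hom mJ IJ k2.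
have [r|f fE] := @factor_surj R _ _ _ (mul_map t1) (mul_map (a *: t2)) (mul_map_surj sim1 k1.1).
  by rewrite !mul_mapE => /(killed_by_ann mI k1) /Ia.
by exists f; have := fE 1; rewrite !mul_mapE !scale1r => ->.
Qed.

Lemma cyclic_hom_of_map I J T1 T2 (t1 : T1) (t2 : T2) (f : {linear T1 -> T2}) x :
  maximal_left_ideal J -> simple_module T1 -> simple_module T2 ->
  killed_by I t1 -> killed_by J t2 -> f x <> 0 -> cyclic_hom I J.
Proof.
move=> mJ sim1 sim2 k1 k2 fx.
have [a aE] := mul_map_surj sim2 k2.1 (f t1); rewrite mul_mapE in aE.
exists a => [Ja|r Ir].
  have [r rE] := mul_map_surj sim1 k1.1 x; apply: fx.
  by rewrite -rE mul_mapE linearZ /= -aE (k2.2 _ Ja) scaler0.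
by apply: (killed_by_ann mJ k2); rewrite -scalerA aE -linearZ /= (k1.2 _ Ir) linear0.
Qed.

End SimpleModules.

(** * Injective hulls of simple modules *)

Section Hulls.
Variables (R : nzRingType) (E : lmodType R).
Hypotheses (injE : injective_module E) (finE : finlen E).
Implicit Types (I J : set R) (M T : lmodType R).

(* [f] is an idempotent whose image is an injective hull of the simple
   submodule generated by [x]. *)
Definition hull (f : {linear E -> E}) (x : E) : Prop :=
  [/\ forall y, f (f y) = f y, f x = x, x <> 0
    & forall y, f y <> 0 -> exists r : R, r *: f y = x].

(** A maximal essential extension [H] of [Rx] is split off by a maximal submodule [C] avoiding [x].
    The inclusion of [H] extends to [E/C], and the resulting [f] has kernel [C] and a range still
    essential over [x], hence equal to [H]. The idempotent [f0] confines the hull to a prescribed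
    summand. *)
Lemma hull_exists I (f0 : {linear E -> E}) x : maximal_left_ideal I ->
  killed_by I x -> (forall y, f0 (f0 y) = f0 y) -> f0 x = x ->
  exists f, hull f x /\ forall y, f0 (f y) = f y.
Proof.
move=> mI [x0 Ix] f00 f0x.
pose ess (S : set E) := [/\ S x, forall y, S y -> f0 y = y
  & forall y, S y -> y <> 0 -> exists r : R, r *: y = x].
have [|H [hH [Hx Hf Hess] Hmax]] := @finlen_max R E ess (cyc x) finE (submod_cyc x).
  split=> [|_ [r ->]|_ [r ->] rx]; [exact: cyc_id|by rewrite linearZ /= f0x|].
  have Ir : ~ I r by move=> /Ix.
  have [c Ic] := maximal_left_ideal_inv mI Ir; exists c; rewrite scalerA.
  by apply/esym/subr0_eq; rewrite -{1}[x]scale1r -scalerBl Ix.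
have [C [hC _ Cx Cmax]] := max_avoiding (submod_set0 E) x0.
have [N [i [inj_i iP]]] := subm_exists hH.
have [Q [q [surj_q qC]]] := quom_exists hC.
have [n|k kE] := @injective_ext R E N Q (q \o i) i injE.
  move=> /qC Cin; apply: contrapT => in0.
  have [|r rx] := Hess (i n) _ in0; first by apply/iP; exists n.
  by apply: Cx; rewrite -rx; apply: submodZ.
pose f : {linear E -> E} := f0 \o k \o q.
have fH y : H y -> f y = y.
  by move=> Hy; have [n nE] := (iP y).1 Hy; rewrite -nE /f /= [k _]kE nE Hf.
have fC y : C y -> f y = 0 by move=> /qC qy; rewrite /f /= qy !linear0.
have kerf y : f y = 0 -> C y.
  apply: (Cmax _ (submod_ker f)) => [z /fC //|fx0].
  by apply: x0; rewrite -(fH _ Hx); apply: fx0.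
have f0f y : f0 (f y) = f y by rewrite /f /= f00.
have essf : ess (range f).
  split=> [|_ [y _ <-] //|_ [y _ <-] fy].
    by exists x => //; apply: fH.
  have hadd : submodule (addset C (cyc y)) by apply: submod_add => //; apply: submod_cyc.
  have [[c [_ [Cc [r ->] xE]]]|nx] := pselect (addset C (cyc y) x).
    by exists r; rewrite -linearZ -[RHS](fH _ Hx) xE linearD (fC _ Cc) add0r.
  case: fy; apply: fC; apply: (Cmax _ hadd) => //.
    by apply: addset_subl; apply: submod_cyc.
  exact: addset_subr (cyc_id y).
have fin y : H (f y).
  apply: (Hmax _ (submod_range f) essf); last by exists y.
  by move=> z Hz; exists z => //; apply: fH.
exists f; split=> //; split=> // [y||y fy]; [exact: fH|exact: fH|].
exact: Hess.
Qed.

(* An endomorphism into a hull which does not kill the socle of another hull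
   maps the latter onto the former. *)
Lemma hull_onto f1 x1 f2 x2 (F : {linear E -> E}) : hull f1 x1 -> hull f2 x2 ->
  (forall y, f2 (F y) = F y) -> F x1 <> 0 -> forall y, exists w, F (f1 w) = f2 y.
Proof.
move=> [f11 f1x _ ess1] [f22 f2x x20 ess2] f2F Fx1 y.
(* [F] is injective on the first hull, as a kernel would contain its socle; [h] inverts it on the
   image. *)
have [w|h hE] := @injective_ext R E _ _ (F \o f1) f1 injE.
  move=> /= Fw; apply: contrapT => /ess1 [r rx]; apply: Fx1.
  by rewrite -rx linearZ /= Fw scaler0.
have {}hE w : h (F (f1 w)) = f1 w := hE w.
pose z := f2 y - F (f1 (h (f2 y))).
have f2z : f2 z = z by rewrite /z linearB f22 f2F.
have hz : f1 (h z) = 0.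
  rewrite /z linearB linearB /= (hE (h (f2 y))).
  by rewrite f11 subrr.
(* If [z] were nonzero, [x2] would be a multiple of both [z] and [F x1]; the map [f1 \o h] kills the
   former and sends [s *: F x1] to [s *: x1], forcing [x2 = 0]. *)
exists (h (f2 y)); apply/esym/subr0_eq; rewrite -/z; apply: contrapT => z0.
have [|r rz] := ess2 z; first by rewrite f2z.
have [|s sF] := ess2 (F x1); first by rewrite f2F.
rewrite f2z in rz; rewrite f2F in sF.
have x1z : s *: x1 = 0.
  have <- : f1 (h (F (f1 (s *: x1)))) = s *: x1 by rewrite hE f11 linearZ /= f1x.
  have -> : F (f1 (s *: x1)) = r *: z by rewrite linearZ /= f1x linearZ /= sF rz.
  by rewrite !linearZ /= hz scaler0.
by apply: x20; rewrite -sF -linearZ x1z linear0.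
Qed.

(* The hull of the simple module [R/I] in [E] has [R/J] as a quotient. *)
Definition socle_top I J : Prop :=
  exists (f : {linear E -> E}) (x : E) (T : lmodType R) (t : T) (p : {linear E -> T}),
    [/\ hull f x, killed_by I x, simple_module T, killed_by J t
      & exists y, p (f y) <> 0].

Lemma socle_top_exists I x : maximal_left_ideal I -> killed_by I (x : E) ->
  exists2 J, maximal_left_ideal J & socle_top I J.
Proof.
move=> mI kx; have [//|//|f [hf _]] := @hull_exists I idfun x mI kx.
have [ff fx x0 _] := hf.
have [|N [mN fN]] := maximal_submod_exists finE (submod_ker f).
  by move=> /(_ x Logic.I) /= fx0; apply: x0; rewrite -fx.
have [T [p [simT surj_p pN]]] := quotient_simple mN.
have [_ nN _] := mN.
have [y Ny] : exists y, ~ N y.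
  by apply: contrapT => h; apply: nN => y _; apply: contrapT => Ny; apply: h; exists y.
exists [set r : R | N (r *: y)]; first exact: maximal_submod_ideal.
exists f, x, T, (p y), p; split=> //.
  by split=> [/pN //|r Nry]; rewrite -linearZ; apply/pN.
exists y => pfy; apply: Ny; apply/pN; rewrite -[y](subrK (f y)) linearD pfy addr0.
by apply/pN; apply: fN; rewrite /= linearB ff subrr.
Qed.

Hypothesis projE : projective_module E.

Fixpoint lin_iter (f : {linear E -> E}) n : {linear E -> E} :=
  if n is m.+1 then f \o lin_iter f m else idfun.

(** Projectivity lifts an isomorphism of the tops and its reverse to [f] and [g], and the composite
    [phi] induces the identity on the top. It remains to see that [phi], hence [f], does not kill
    the socle. *)
Lemma socle_top_inj I1 J1 I2 J2 : maximal_left_ideal I1 -> maximal_left_ideal J1 ->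
  maximal_left_ideal I2 -> maximal_left_ideal J2 ->
  socle_top I1 J1 -> socle_top I2 J2 -> cyclic_hom J1 J2 -> cyclic_hom I1 I2.
Proof.
move=> mI1 mJ1 mI2 mJ2 [f1 [x1 [T1 [t1 [p1 [hf1 kx1 sim1 kt1 [y1 py1]]]]]]].
move=> [f2 [x2 [T2 [t2 [p2 [hf2 kx2 sim2 kt2 [y2 py2]]]]]]] J12.
have [th tht] := simple_transport mJ1 mJ2 sim1 kt1 kt2 J12.
have [f11 f1x x10 ess1] := hf1; have [f22 f2x x20 ess2] := hf2.
pose p : {linear E -> T2} := th \o p1 \o f1; pose q : {linear E -> T2} := p2 \o f2.
have surj_q : surjective q by apply: (simple_surj (y := y2)).
have [y0 y0E] : exists y, p1 (f1 y) = t1.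
  have surj1 : surjective (p1 \o f1 : {linear E -> T1}) by apply: (simple_surj (y := y1)).
  exact: surj1.
have py0 : p y0 <> 0 by rewrite /p /= y0E.
have surj_p : surjective p by apply: (simple_surj (y := y0)).
have [f fE] := projE p surj_q; have [g gE] := projE q surj_p.
have pf1 y : p (f1 y) = p y by rewrite /p /= f11.
have qf2 y : q (f2 y) = q y by rewrite /q /= f22.
pose phi : {linear E -> E} := f1 \o g \o f2 \o f \o f1.
have phiE y : phi y = f1 (g (f2 (f (f1 y)))) by [].
have pphi y : p (phi y) = p y by rewrite phiE pf1 gE qf2 fE pf1.
have phix : phi x1 <> 0.
  move=> phix0.
  (* Fitting's argument: the kernels of the iterates become stationary. Exponents start at 1 so that
     iterates lie in the image of [f1]; there a nonzero value has [x1] as a multiple, and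
     [phi x1 = 0] would enlarge the kernel once more. *)
  have [_ [_ [n ->] nmax]] := @finlen_max R E
    (fun S => exists n, S = [set y | lin_iter phi n.+1 y = 0]) _ finE
    (submod_ker (lin_iter phi 1)) (ex_intro _ 0%N erefl).
  have itS m y : lin_iter phi m.+1 y = phi (lin_iter phi m y) by [].
  have pit m y : p (lin_iter phi m y) = p y.
    by elim: m => [|m IHm] //; rewrite itS pphi.
  have z0 : f1 (lin_iter phi n.+1 y0) <> 0.
    by move=> /(congr1 p); rewrite pf1 pit linear0.
  have [r rz] := ess1 _ z0.
  have f1it : f1 (lin_iter phi n.+1 y0) = lin_iter phi n.+1 y0.
    by rewrite itS phiE f11.
  have : lin_iter phi n.+1 (r *: y0) = 0.
    apply: (nmax [set y | lin_iter phi n.+2 y = 0] (submod_ker (lin_iter phi n.+2))).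
    - by exists n.+1.
    - move=> y yker; have {}yker : lin_iter phi n.+1 y = 0 := yker.
      by rewrite -[_ y]/(lin_iter phi n.+2 y = 0) itS yker linear0.
    - rewrite -[_ _]/(lin_iter phi n.+2 (r *: y0) = 0) itS.
      by rewrite [lin_iter _ _ _]linearZ -f1it /= rz.
  by rewrite linearZ -f1it /= rz.
have u0 : f2 (f x1) <> 0.
  by move=> u0; apply: phix; rewrite phiE f1x u0 !linear0.
have [r rx] := ess2 _ u0.
apply: cyclic_hom_sym => //; exists r => [Ir|s Is].
  by apply: x20; rewrite -rx -!linearZ /= kx1.2 // !linear0.
apply: (killed_by_ann (x := f2 (f x1)) mI1); last by rewrite -scalerA rx kx2.2.
by split=> // a Ia; rewrite -!linearZ /= kx1.2 // !linear0.
Qed.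

(** An isomorphism of socles extends to a map of the first hull onto the second, so the first hull
    also has [T2] as a quotient, via [q]. If the tops differed, [p] would lift through the kernel of
    [q], giving [be] with [q \o be = 0] and [p \o be = p]. One of [be] and [f1 - be] does not kill
    the socle and is therefore onto the hull, but the former is killed by [q] and the latter by
    [p]. *)
Lemma socle_top_fun I1 J1 I2 J2 : maximal_left_ideal I1 -> maximal_left_ideal J1 ->
  maximal_left_ideal I2 -> maximal_left_ideal J2 ->
  socle_top I1 J1 -> socle_top I2 J2 -> cyclic_hom I1 I2 -> cyclic_hom J1 J2.
Proof.
move=> mI1 mJ1 mI2 mJ2 [f1 [x1 [T1 [t1 [p1 [hf1 kx1 sim1 kt1 [y1 py1]]]]]]].
move=> [f2 [x2 [T2 [t2 [p2 [hf2 kx2 sim2 kt2 [y2 py2]]]]]]] I12.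
have [f11 f1x x10 ess1] := hf1; have [f22 f2x x20 ess2] := hf2.
have [a kax Ia] := killed_by_hom mI2 I12 kx2.
have [r|f fE] := @injective_ext R E _ _ (mul_map x1) (mul_map (a *: x2)) injE.
  by rewrite !mul_mapE => /(killed_by_ann mI1 kx1); apply: kax.2.
have fx1 : f x1 = a *: x2 by have := fE 1; rewrite !mul_mapE !scale1r.
pose F : {linear E -> E} := f2 \o f \o f1.
have Fx1 : F x1 = a *: x2 by rewrite /F /= f1x fx1 linearZ /= f2x.
have onto y : exists w, F (f1 w) = f2 y.
  apply: (hull_onto hf1 hf2) => [z|]; first by rewrite /F /= f22.
  by rewrite Fx1; apply: kax.1.
pose p : {linear E -> T1} := p1 \o f1; pose q : {linear E -> T2} := p2 \o F.
have Ff1 y : F (f1 y) = F y by rewrite /F /= f11.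
have pf1 y : p (f1 y) = p y by rewrite /p /= f11.
have qf1 y : q (f1 y) = q y by rewrite -[LHS]/(p2 (F (f1 y))) Ff1.
have [w wE] := onto y2; have qw : q w <> 0 by rewrite -[q w]/(p2 (F w)) -Ff1 wE.
have surj_q : surjective q by apply: (simple_surj (y := w)).
apply: contrapT => nJ.
have [v [qv pv]] : exists v, q v = 0 /\ p v <> 0.
  apply: contrapT => h; apply: nJ.
  have [z qz|th thE] := @factor_surj R _ _ _ q p surj_q.
    by apply: contrapT => pz; apply: h; exists z.
  apply: cyclic_hom_sym => //.
  by apply: (@cyclic_hom_of_map _ _ _ _ _ t2 t1 th (q y1)) => //; rewrite thE.
have [N [i [inj_i iP]]] := subm_exists (submod_ker q).
have [n nE] := (iP v).1 qv.
have surj_pi : surjective (p \o i : {linear N -> T1}).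
  by apply: (simple_surj (y := n)) => //=; rewrite nE.
have [al0 alE] := projE p surj_pi.
pose al : {linear E -> E} := i \o al0.
have pal y : p (al y) = p y by exact: alE.
have qal y : q (al y) = 0 by apply/iP; exists (al0 y).
pose be : {linear E -> E} := f1 \o al \o f1.
have beE y : be y = f1 (al (f1 y)) by [].
have [bex0|bex] := pselect (be x1 = 0); last first.
  have [|w' w'E] := hull_onto hf1 hf1 (F := be) _ bex w; first by move=> z; rewrite beE f11.
  by apply: qw; rewrite -qf1 -w'E beE qf1 qal.
pose ga : {linear E -> E} := f1 \- be.
have gaE y : ga y = f1 y - f1 (al (f1 y)) by [].
have [||w' w'E] := hull_onto hf1 hf1 (F := ga) _ _ y1.
- by move=> z; rewrite gaE linearB !f11.
- by rewrite gaE -beE bex0 subr0 f1x.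
apply: py1; rewrite -[p1 _]/(p y1) -pf1 -w'E gaE linearB !pf1 pal !pf1.
exact: subrr.
Qed.

End Hulls.

(** * Self-injectivity and embeddings of simple modules *)

Section QuasiFrobenius.
Variable R : nzRingType.
Hypothesis finR : @finlen R R^o.

(* If every simple module embeds in [E], the pigeonhole makes every simple
   module a quotient of [E], so [E] is a generator and [R] a summand of a power
   of [E]. *)
Lemma cogenerator_self_injective (E : lmodType R) : injective_module E ->
  projective_module E -> finlen E ->
  (forall I, maximal_left_ideal I -> exists x : E, killed_by I x) ->
  self_injective R.
Proof.
move=> injE projE finE cog.
have hit := pigeonhole finR _ (socle_top_inj finE projE).
(* The trace ideal of [E]. If it were proper, a maximal left ideal [J] above it would give a
   quotient [R/J] of [E]; lifting the quotient map to [E -> R] puts its values in the trace, hence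
   in [J], so the map would be zero. *)
pose tr : set R^o := [set r | exists s : seq ({linear E -> R^o} * E),
  r = \sum_(p <- s) p.1 p.2].
have htr : submodule tr.
  split=> [|r _ _ [s ->] [s' ->]]; first by exists [::]; rewrite big_nil.
  exists ([seq (p.1, r *: p.2) | p <- s] ++ s'); rewrite big_cat big_map scaler_sumr.
  by congr (_ + _); apply: eq_bigr => p _ /=; rewrite linearZ.
have tr1 : tr 1.
  apply: contrapT => tr1.
  have [|J [mJ trJ]] := maximal_submod_exists finR htr; first by move=> h; apply/tr1/h.
  have {}mJ := (maximal_left_ideal_submod J).2 mJ.
  have [I mI|I [J' [mI mJ' [f [x [T [t [p [_ _ simT kt [y py]]]]]]] J'J]]] := hit _ J mJ.
    by have [x kx] := cog I mI; apply: (socle_top_exists injE finE mI kx).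
  have [a [at0 Ja] _] := killed_by_hom mJ' (cyclic_hom_sym mJ' mJ J'J) kt.
  have [h hE] := projE _ _ _ p (mul_map_surj simT at0).
  apply: py; rewrite -hE mul_mapE; apply: Ja; apply: trJ.
  by exists [:: (h, f y)]; rewrite big_seq1.
(* Writing [1] as a trace makes [R] a retract of a power of [E]; the extension problem is solved in
   each component. *)
have [s sE] := tr1.
move=> A B f g inj_f.
have /choice [H HE] : forall p : {linear E -> R^o} * E,
    exists h : {linear B -> E}, forall a, h (f a) = (g a : R) *: p.2.
  move=> p; have [h hE] := injE _ _ f (mul_map p.2 \o g : {linear A -> E}) inj_f.
  by exists h => a; rewrite hE.
have hl : linear (fun b => \sum_(p <- s) p.1 (H p b)).
  move=> r x y; rewrite scaler_sumr -big_split; apply: eq_bigr => p _ /=.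
  by rewrite !linearP.
exists (mk_linear hl) => a; rewrite mk_linearE -[RHS]mulr1 sE mulr_sumr.
by apply: eq_bigr => p _; rewrite HE linearZ.
Qed.

(** A minimal nonzero submodule of [S] is simple, so the annihilator of any nonzero element of it is
    maximal. *)
Lemma simple_left_ideal (M : lmodType R) (S : set M) : finlen M -> submodule S ->
  ~ (S `<=` [set 0]) -> exists I x, [/\ maximal_left_ideal I, killed_by I x & S x].
Proof.
move=> finM hS nS.
have [|X [hX [XS nX] Xmin]] := @finlen_min R M
  (fun X => X `<=` S /\ ~ (X `<=` [set 0])) S finM hS; first by split.
have [x Xx x0] : exists2 x, X x & x <> 0.
  by apply: contrapT => h; apply: nX => x Xx; apply: contrapT => x0; apply: h; exists x.
exists [set r : R | r *: x = 0], x; split; [|by split|exact: XS].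
split.
  split=> [|TI].
    split=> [|r a b] /=; first by rewrite scale0r.
    by rewrite scalerDl -scalerA => -> ->; rewrite scaler0 addr0.
  have T1 : [set r : R | r *: x = 0] 1 by rewrite TI.
  by apply: x0; rewrite -[x]scale1r.
move=> J pJ IJ; apply/seteqP; split=> // r Jr /=; apply: contrapT => rx.
have [hJ _] := pJ.
have [||s sE] := Xmin (cyc (r *: x)) (submod_cyc _) _ _ x Xx.
- split=> [y [s ->]|h]; last by apply/rx/h/cyc_id.
  by apply: submodZ => //; apply: XS; apply: submodZ.
- by apply: cyc_sub => //; apply: submodZ.
apply: (proper_left_ideal1 pJ); rewrite -[1](subrK (s * r)).
apply: (submodD (M := R^o) hJ); last exact: left_idealM.
by apply: IJ; rewrite /= scalerBl scale1r -scalerA -sE subrr.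
Qed.

(** The pigeonhole is applied to the assignment from tops to socles of hulls inside [R]:
    [socle_top_fun] makes it injective, and being onto means that every simple module is a socle in
    [R]. What must be shown by hand is that every simple module occurs as a top. *)
Lemma self_injective_annihilators : self_injective R ->
  forall I, maximal_left_ideal I -> exists x : R^o, killed_by I x.
Proof.
move=> injR I mI; have projR := @projective_regular R.
have hit := @pigeonhole R (fun J I => socle_top R^o I J) finR _ _ I mI.
have [J mJ|J1 I1 J2 I2 mJ1 mI1 mJ2 mI2 h1 h2|J [I' [mJ mI' [f [x [T [t [p [_ kx _ _ _]]]]]] I'I]]] := hit.
- have [T [p [simT surj_p pJ]]] := quotient_simple ((maximal_left_ideal_submod J).1 mJ).
  have kt : killed_by J (p 1).
    split=> [/pJ|r Jr]; first exact: (proper_left_ideal1 mJ.1).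
    by rewrite -linearZ; apply/pJ; rewrite -[_ *: _]/(r * 1) mulr1.
  (* Images of idempotents not killed by the projection to [R/J]; a minimal one turns out to contain
     a hull with top [R/J]. *)
  pose P (S : set R^o) := exists f : {linear R^o -> R^o},
    [/\ S = range f, forall y, f (f y) = f y & exists y, p (f y) <> 0].
  have [|_ [_ [f0 [-> f00 [y0 py0]]] fmin]] := @finlen_min R R^o P setT finR (submodT R^o).
    exists idfun; split=> //; last by exists 1; apply: kt.1.
    by apply/seteqP; split=> // z _; exists z.
  have [|K [x [mK kx [z _ zx]]]] := @simple_left_ideal R^o (range f0) finR (submod_range f0).
    move=> h; apply: py0; have : [set (0 : R^o)] (f0 y0) by apply: h; exists y0.
    by move=> ->; rewrite linear0.
  have f0x : f0 x = x by rewrite -zx f00.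
  have [f [hf f0f]] := hull_exists injR finR mK kx f00 f0x.
  exists K => //; exists f, x, T, (p 1), p; split=> //.
  have [ff fx x0 _] := hf.
  apply: contrapT => npf; have pf y : p (f y) = 0.
    by apply: contrapT => pfy; apply: npf; exists y.
  (* If [p] killed the hull, removing it from the summand would leave a smaller idempotent image
     still not killed by [p]. *)
  pose rho : {linear R^o -> R^o} := f0 \- (f \o f0).
  have rhoE y : rho y = f0 y - f (f0 y) by [].
  have f0rho y : f0 (rho y) = rho y by rewrite rhoE linearB f00 f0f.
  have frho y : f (rho y) = 0 by rewrite rhoE linearB ff subrr.
  have rr y : rho (rho y) = rho y by rewrite [LHS]rhoE f0rho frho subr0.
  have [|||w _ wE] := fmin (range rho) (submod_range rho) _ _ x.
  + exists rho; split=> //; exists y0; rewrite rhoE linearB pf subr0; exact: py0.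
  + by move=> _ [y _ <-]; exists (rho y).
  + by exists x.
  by apply: x0; rewrite -fx -wE frho.
- exact: (socle_top_fun injR projR).
have [a k _] := killed_by_hom mI' (cyclic_hom_sym mI' mI I'I) kx.
by exists (a *: x).
Qed.

End QuasiFrobenius.

(** A nonzero map from the simple module to a flat term factors through a free module, and some
    coordinate of the first factor is nonzero on the generator. *)
Lemma grade_finite_embeds (R : nzRingType) (E : min_injective_resolution R^o) I :
  @finlen R R^o -> (forall i, flat (E i)) ->
  (forall S : lmodType R, simple_module S -> grade_finite S) ->
  maximal_left_ideal I -> exists x : R^o, killed_by I x.
Proof.
move=> finR flatE gr mI.
have [S [p [simS surj_p pI]]] := quotient_simple ((maximal_left_ideal_submod I).1 mI).
have [i [f [s fs]]] := grade_finite_Hom E (gr S simS).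
have [|n [g [h hg]]] := flat_factor finR (flatE i) f.
  exact: fin_generated_image surj_p (fin_generated_regular R).
have pE (r : R) : p r = r *: p 1 by rewrite -linearZ -[_ *: 1]/(r * 1) mulr1.
have g1 : g (p 1) <> 0.
  move=> g1; apply: fs; have [r <-] := surj_p s.
  by rewrite -hg pE linearZ /= g1 scaler0 linear0.
have [j gj] : exists j, g (p 1) j <> 0.
  apply: contrapT => h0; apply: g1; apply/ffunP => j; rewrite ffunE.
  by apply: contrapT => gj; apply: h0; exists j.
exists (g (p 1) j); split=> // r /pI pr.
have : g (p r) j = 0 by rewrite pr linear0 ffunE.
by rewrite pE linearZ ffunE.
Qed.

Theorem corollary2p19 (k : comNzRingType) (L : algType k)
    (artinL : artin_algebra L)
    (domdimL : infinite_dominant_dimension L) :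
  [<-> self_injective L;
       fin_dim_eq L 0;
       forall I : set L, proper_left_ideal I ->
         exists x, right_annihilator I x /\ x <> 0%R;
       forall I : set L, maximal_left_ideal I ->
         exists x, right_annihilator I x /\ x <> 0%R;
       forall M : lmodType L, fin_generated M -> nonzero_module M ->
         grade_finite M;
       forall S : lmodType L, simple_module S -> grade_finite S].
Proof.
have finL := artin_algebra_finlen artinL; have [E flatE] := domdimL.
tfae.
- exact: self_injective_fin_dim.
(* Right annihilators reverse inclusion, so a maximal left ideal above [I] suffices. *)
- move=> [fd0 _] I pI; have injL := fin_dim0_self_injective finL (flatE 0%N) fd0.
  have [|N [mN IN]] := @maximal_submod_exists L L^o I finL pI.1.
    by move=> TI; apply: (proper_left_ideal1 pI); apply: TI.
  have mN' := (maximal_left_ideal_submod N).2 mN.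
  have [x [x0 Nx]] := self_injective_annihilators finL injL mN'.
  by exists x; split=> // y /IN /Nx.
- by move=> h I [pI _]; apply: h.
- exact: annihilators_grade_finite.
- move=> h S simS; have [[x x0] _] := simS; apply: h; last exact: simS.1.
  exact: fin_generated_image (mul_map_surj simS x0) (fin_generated_regular L).
(* The zeroth term of the resolution is an injective, finitely generated projective module that
   receives every simple module through [L], so the cogenerator argument applies to it. *)
- move=> gr; have inj_u := @ires_aug_inj _ _ E.
  have fgE := flat_hull_fin_generated finL (flatE 0%N) inj_u (@ires_min0 _ _ E).
  apply: (cogenerator_self_injective finL (E := E 0%N)).
  + exact: ires_injective.
  + exact: fin_generated_flat_projective finL (flatE 0%N) fgE.
  + exact: finlen_fin_generated.
  + move=> I mI; have [x [x0 Ix]] := grade_finite_embeds finL flatE gr mI.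
    exists (ires_aug E x); split=> [ux|r /Ix rx]; last by rewrite -linearZ /= rx linear0.
    by apply: x0; apply: inj_u; rewrite ux linear0.
Qed.
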